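(* Let $n\ge 1$. (i) If for every integer $m\ge1$ one has $L_K\le L_{[-1,1]^{n+m}}=\frac{1}{\sqrt{12}}$ for every centrally symmetric convex body $K\subset\mathbb{R}^{n+m}$, then $\widehat{L}_f\le \widehat{L}_{f_\infty}=\frac{1}{\sqrt{12}}$ for every integrable log-concave even function $f:\mathbb{R}^n\to[0,+\infty)$ with $\int f>0$. (ii) If $\widehat{L}_f\le \widehat{L}_{f_\infty}=\frac1{\sqrt{12}}$ for every integrable log-concave even function $f:\mathbb{R}^n\to[0,+\infty)$ with $\int f>0$, then $L_K\le L_{[-1,1]^n}=\frac1{\sqrt{12}}$ for every centrally symmetric convex body $K\subset\mathbb{R}^n$.
   Context: A convex body is a compact convex set with nonempty interior; $K$ is centrally symmetric if $K=-K$. For a convex body $K\subset\mathbb{R}^d$, $$\mathrm{bar}(K)=\frac{1}{\mathrm{vol}(K)}\int_K x\,dx,\quad \mathrm{Cov}(K)=\frac{1}{\mathrm{vol}(K)}\int_K xx^T\,dx-\mathrm{bar}(K)\mathrm{bar}(K)^T,\quad L_K=\frac{(\det\mathrm{Cov}(K))^{1/(2d)}}{\mathrm{vol}(K)^{1/d}}.$$ A function $f:\mathbb{R}^n\to[0,+\infty)$ is log-concave if $f=e^{-\varphi}$ with $\varphi:\mathbb{R}^n\to\mathbb{R}\cup\{+\infty\}$ convex. Here $f_\infty=\chi_{[-1,1]^n}$ is the characteristic function of the cube $[-1,1]^n$. For integrable log-concave $f$ with $\int f>0$, $$\mathrm{bar}(f)=\frac{\int xf(x)\,dx}{\int f},\quad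 \mathrm{Cov}(f)=\frac{\int xx^Tf(x)\,dx}{\int f}-\mathrm{bar}(f)\mathrm{bar}(f)^T,\quad h(f)=-\frac{\int f\log f}{\int f}$$ (with $0\log0=0$), and $$\widehat{L}_f=\left(\frac{e^{-h(f)}}{\int f}\right)^{1/n}\bigl(\det\mathrm{Cov}(f)\bigr)^{1/(2n)}.$$ *)

(* Defs.v *)
From HB Require Import structures.
From mathcomp Require Import all_boot all_order all_algebra.
From mathcomp Require Import all_classical all_reals all_analysis.

Set Implicit Arguments.
Unset Strict Implicit.
Unset Printing Implicit Defensive.

Import Order.TTheory GRing.Theory Num.Theory.
Import numFieldNormedType.Exports.

Local Open Scope classical_set_scope.
Local Open Scope ring_scope.

(* The library has no n-dimensional Lebesgue measure.  It is built here on
   R^n = 'rV[R]_n as the iterated product of the one-dimensional one on the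
   product (= Borel) sigma-algebra, and is then completed with the library's
   completed_measure_extension.  The completion is needed because log-concave
   functions are Lebesgue measurable but in general not Borel measurable. *)

Section lebesgue_rV.
Context (R : realType).

Definition cylinders (n : nat) : set (set 'rV[R]_n) :=
  [set A | exists (i : 'I_n) (B : set (measurableTypeR R)),
    measurable B /\ A = [set x : 'rV[R]_n | B (x ord0 i)]].

Definition borel_rV (n : nat) := g_sigma_algebraType (@cylinders n).

Definition cons_rV (n : nat) (p : measurableTypeR R * borel_rV n) :
    borel_rV n.+1 :=
  \row_i oapp (fun j => (p.2 : 'rV[R]_n) ord0 j) p.1 (unlift ord0 i).

Definition uncons_rV (n : nat) (x : borel_rV n.+1) :
    measurableTypeR R * borel_rV n :=
  ((x : 'rV[R]_n.+1) ord0 ord0,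
   \row_j (x : 'rV[R]_n.+1) ord0 (lift ord0 j)).

Lemma cons_rVK n : cancel (@cons_rV n) (@uncons_rV n).
Proof.
move=> [t v]; rewrite /uncons_rV /cons_rV !mxE unlift_none; congr pair.
by apply/rowP => j; rewrite !mxE liftK.
Qed.

Lemma measurable_coord n (i : 'I_n) :
  measurable_fun [set: borel_rV n]
    (fun x => (x : 'rV[R]_n) ord0 i : measurableTypeR R).
Proof.
by move=> _ B mB; rewrite setTI; apply: sub_sigma_algebra; exists i, B.
Qed.

Lemma measurable_fun_rV d (T : measurableType d) n (f : T -> borel_rV n) :
  (forall i, measurable_fun setT
     (fun t => (f t : 'rV[R]_n) ord0 i : measurableTypeR R)) ->
  measurable_fun setT f.
Proof.
move=> mf; apply: (@measurability _ _ _ (borel_rV n) _ _ (@cylinders n)) => //.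
by move=> _ [_ [i [B [mB ->]]] <-]; exact: (mf i).
Qed.

Lemma measurable_cons_rV n : measurable_fun setT (@cons_rV n).
Proof.
apply: measurable_fun_rV => i.
have [j ->|->] := unliftP ord0 i.
- rewrite [X in measurable_fun _ X](_ : _ =
    (fun x : borel_rV n => (x : 'rV[R]_n) ord0 j) \o snd); last first.
    by apply/funext => p /=; rewrite mxE liftK.
  by apply: measurableT_comp; first exact: measurable_coord.
- rewrite [X in measurable_fun _ X](_ : _ = fst) //.
  by apply/funext => p /=; rewrite mxE unlift_none.
Qed.

Lemma measurable_uncons_rV n : measurable_fun setT (@uncons_rV n).
Proof.
apply/measurable_fun_pairP; split; first exact: measurable_coord.
apply: measurable_fun_rV => j.
rewrite [X in measurable_fun _ X](_ : _ =
  fun x : borel_rV n.+1 => (x : 'rV[R]_n.+1) ord0 (lift ord0 j)).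
  exact: measurable_coord.
by apply/funext => x /=; rewrite mxE.
Qed.

Section step.
Context (n : nat) (mu : {sigma_finite_measure set (borel_rV n) -> \bar R}).

Definition lebesgue_step : set (borel_rV n.+1) -> \bar R :=
  pushforward (lebesgue_measure \x mu)%E (@cons_rV n).

Let mcons := @measurable_cons_rV n.

Let step0 : lebesgue_step set0 = 0%E.
Proof. exact: (measure0 (pushforward _ _)). Qed.

Let step_ge0 A : (0 <= lebesgue_step A)%E.
Proof. exact: (measure_ge0 (pushforward _ _)). Qed.

Let step_sigma_additive : semi_sigma_additive lebesgue_step.
Proof. exact: (@measure_semi_sigma_additive _ _ _ (pushforward _ _)). Qed.

HB.instance Definition _ := isMeasure.Build _ _ _ lebesgue_step
  step0 step_ge0 step_sigma_additive.

Let step_sigma_finite : sigma_finite setT lebesgue_step.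
Proof.
have /sigma_finiteP[F [FT ndF Foo]] := sigma_finiteT (@lebesgue_measure R).
have /sigma_finiteP[G [GT ndG Goo]] := sigma_finiteT mu.
exists (fun k => @uncons_rV n @^-1` (F k `*` G k)).
  apply/esym; rewrite -subTset => x _.
  have [k _ Fk] : (\bigcup_k F k) (uncons_rV x).1 by rewrite -FT.
  have [l _ Gl] : (\bigcup_k G k) (uncons_rV x).2 by rewrite -GT.
  exists (maxn k l) => //; split.
  - by move: Fk; exact/subsetPset/ndF/leq_maxl.
  - by move: Gl; exact/subsetPset/ndG/leq_maxr.
move=> k; have [mF Fk] := Foo k; have [mG Gk] := Goo k; split.
  rewrite -[X in measurable X]setTI; apply: measurable_uncons_rV => //.
  exact: measurableX.
rewrite /lebesgue_step /pushforward (_ : _ @^-1` _ = F k `*` G k).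
  by rewrite product_measure1E// lte_mul_pinfty// ge0_fin_numE.
by apply/seteqP; split => p; rewrite /preimage /mkset cons_rVK.
Qed.

HB.instance Definition _ := Measure_isSigmaFinite.Build _ _ _ lebesgue_step
  step_sigma_finite.

End step.

Fixpoint borel_lebesgue (n : nat) :
    {sigma_finite_measure set (borel_rV n) -> \bar R} :=
  match n with
  | 0 => @dirac _ (borel_rV 0) (0 : 'rV[R]_0) R
  | n'.+1 => lebesgue_step (borel_lebesgue n')
  end.

Definition lebesgue_rV (n : nat) :=
  @completed_measure_extension _ _ _ (borel_lebesgue n).

Lemma measurable_box n (B : 'I_n -> set (measurableTypeR R)) :
  (forall i, measurable (B i)) ->
  measurable [set x : borel_rV n | forall i, B i ((x : 'rV[R]_n) ord0 i)].
Proof.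
move=> mB.
rewrite (_ : mkset _ = \bigcap_(i in [set: 'I_n])
    [set x : borel_rV n | B i ((x : 'rV[R]_n) ord0 i)]); last first.
  apply: funext => x; apply: propext.
  by split => /= h i; [move=> _; exact: h|exact: (h i I)].
apply: fin_bigcap_measurable; first exact: finite_finset.
move=> i _; rewrite -[X in measurable X]setTI.
exact: (@measurable_coord n i measurableT _ (mB i)).
Qed.

Lemma borel_lebesgue_box n (B : 'I_n -> set (measurableTypeR R)) :
  (forall i, measurable (B i)) ->
  borel_lebesgue n [set x : 'rV[R]_n | forall i, B i (x ord0 i)] =
  (\prod_(i < n) lebesgue_measure (B i))%E.
Proof.
elim: n B => [|n IH] B mB.
  by rewrite big_ord0 /= diracE mem_set//; case.
rewrite big_ord_recl -IH; last by move=> i; exact: mB.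
rewrite -product_measure1E//; last first.
  exact: (@measurable_box n (fun i => B (lift ord0 i))).
rewrite /= /lebesgue_step /pushforward; congr (product_measure1 _ _ _).
apply/seteqP; split => -[t v] /=.
  move=> h; split; first by have := h ord0; rewrite mxE unlift_none.
  by move=> i; have := h (lift ord0 i); rewrite mxE liftK.
by move=> [h1 h2] i; rewrite mxE; have [j ->|->] := unliftP ord0 i.
Qed.

Lemma lebesgue_rV_borel n (A : set (borel_rV n)) :
  measurable A -> @lebesgue_rV n A = borel_lebesgue n A.
Proof. by move=> mA; exact: measurable_mu_extE. Qed.

Lemma lebesgue_rV_box n (B : 'I_n -> set (measurableTypeR R)) :
  (forall i, measurable (B i)) ->
  @lebesgue_rV n [set x : 'rV[R]_n | forall i, B i (x ord0 i)] =
  (\prod_(i < n) lebesgue_measure (B i))%E.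
Proof.
by move=> mB; rewrite lebesgue_rV_borel ?borel_lebesgue_box//; exact: measurable_box.
Qed.

End lebesgue_rV.
Arguments lebesgue_rV R n : clear implicits.

Definition cube (R : realType) (d : nat) : set 'rV[R]_d :=
  [set x : 'rV[R]_d | forall i, -1 <= x 0 i <= 1].
Arguments cube R d : clear implicits.

Definition f_infty (R : realType) (n : nat) : 'rV[R]_n -> R := \1_(cube R n).
Arguments f_infty R n : clear implicits.

Section isotropic_constants.
Context (R : realType).

Definition convex_body (d : nat) (K : set 'rV[R]_d) : Prop :=
  [/\ convex_set K, compact K & K° !=set0].

Definition centrally_symmetric (d : nat) (K : set 'rV[R]_d) : Prop :=
  K = -%R @` K.

Definition vol (d : nat) (K : set 'rV[R]_d) : R := fine (lebesgue_rV R d K).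

Definition barycenter (d : nat) (K : set 'rV[R]_d) : 'rV[R]_d :=
  \row_i ((vol K)^-1 * \int[lebesgue_rV R d]_(x in K) (x : 'rV[R]_d) 0 i).

(* Vectors are rows, so that x x^T reads x^T *m x. *)
Definition covariance_mx (d : nat) (K : set 'rV[R]_d) : 'M[R]_d :=
  \matrix_(i, j) ((vol K)^-1 *
    \int[lebesgue_rV R d]_(x in K) ((x : 'rV[R]_d) 0 i * (x : 'rV[R]_d) 0 j))
  - (barycenter K)^T *m barycenter K.

Definition isotropic_constant (d : nat) (K : set 'rV[R]_d) : R :=
  (\det (covariance_mx K)) `^ ((2 * d%:R)^-1) / (vol K) `^ (d%:R^-1).

(* In \bar R, 0 * +oo = 0 and expeR (-oo) = 0; the last clause makes f
   nonnegative. *)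
Definition log_concave (n : nat) (f : 'rV[R]_n -> R) : Prop :=
  exists phi : 'rV[R]_n -> \bar R,
    [/\ forall x, phi x != -oo%E,
        forall (x y : 'rV[R]_n) (t : R), 0 <= t <= 1 ->
          (phi (t *: x + (1 - t) *: y)%R <=
             t%:E * phi x + (1 - t)%R%:E * phi y)%E
      & forall x, (f x)%:E = expeR (- phi x)].

Definition even_fun (n : nat) (f : 'rV[R]_n -> R) : Prop :=
  forall x, f (- x) = f x.

Definition integrable_rV (n : nat) (f : 'rV[R]_n -> R) : Prop :=
  (lebesgue_rV R n).-integrable setT (EFin \o f).

Definition mass (n : nat) (f : 'rV[R]_n -> R) : R :=
  \int[lebesgue_rV R n]_x f x.

Definition barycenter_fun (n : nat) (f : 'rV[R]_n -> R) : 'rV[R]_n :=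
  \row_i ((\int[lebesgue_rV R n]_x ((x : 'rV[R]_n) 0 i * f x)) / mass f).

Definition covariance_mx_fun (n : nat) (f : 'rV[R]_n -> R) : 'M[R]_n :=
  \matrix_(i, j) ((\int[lebesgue_rV R n]_x
    ((x : 'rV[R]_n) 0 i * (x : 'rV[R]_n) 0 j * f x)) / mass f)
  - (barycenter_fun f)^T *m barycenter_fun f.

Definition entropy (n : nat) (f : 'rV[R]_n -> R) : R :=
  - ((\int[lebesgue_rV R n]_x (f x * ln (f x))) / mass f).

Definition isotropic_constant_fun (n : nat) (f : 'rV[R]_n -> R) : R :=
  (expR (- entropy f) / mass f) `^ (n%:R^-1) *
  (\det (covariance_mx_fun f)) `^ ((2 * n%:R)^-1).

End isotropic_constants.

(* Main.v *)
Require Import Defs.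
From mathcomp Require Import all_boot all_order all_algebra.
From mathcomp Require Import all_classical all_reals all_analysis.
From mathcomp Require Import measurable_realfun ring lra.
From mathcomp Require polyrcf.

(* Part (ii) is the case [f = \1_K].  For part (i), let [m] be large and
   [g = (1 + ln f / m)_+].  Since [ln f] is concave, the set [K_m] of all
   [(x, y)] with [`|y_j| <= g x] for every [j] is a symmetric convex body in
   R^(n+m); it fibres over R^n with cubes as fibres.  Its covariance is block
   diagonal, so that [L_(K_m) <= 1 / sqrt 12] becomes
     det Cov(g^m) * (int g^(m+2) / int g^m)^m <= 12^-n * (int g^m)^2.
   By Jensen's inequality the power on the left is at least [exp (- 2 h(g^m))],
   and [g^m] increases to [f].  Dominated convergence applies because
   [f (x / 4) >= f x ^ (1/4) * f 0 ^ (3/4)], so that [f ^ (1/4)] is integrable,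
   and because an integrable log-concave function that is bounded below on a
   cube is [O (1 / |x|)].  Only an upper semicontinuous [f] gives a compact
   [K_m]: [f] is first replaced by its limit from inside along rays, which
   coincides with [f] almost everywhere. *)

Set Implicit Arguments.
Unset Strict Implicit.
Unset Printing Implicit Defensive.

Import Order.TTheory GRing.Theory Num.Theory.
Import numFieldNormedType.Exports.

Local Open Scope classical_set_scope.
Local Open Scope ring_scope.

Lemma nbhs_rVP (R : realType) n (x : 'rV[R]_n) (A : set 'rV[R]_n) :
  nbhs x A <->
  exists2 e : R, 0 < e & forall y : 'rV[R]_n, (forall i, `|x 0 i - y 0 i| < e) -> A y.
Proof.
split=> [/nbhs_ballP[e /= e0 eA]|[e e0 eA]].
  by exists e => // y xy; apply: eA; split=> // i j; rewrite [i]ord1; exact: xy.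
by apply/nbhs_ballP; exists e => //= y [_ xy]; apply: eA => i; exact: xy.
Qed.

Lemma open_measurable_rV (R : realType) n (A : set 'rV[R]_n) :
  open A -> measurable (A : set (borel_rV R n)).
Proof.
move=> oA.
pose box (p : 'rV[rat]_n * nat) : set 'rV[R]_n :=
  [set x | forall i, ball (ratr (p.1 0 i) : R) p.2.+1%:R^-1 (x 0 i)].
pose F p : set (borel_rV R n) := if `[< box p `<=` A >] then box p else set0.
have -> : A = \bigcup_p F p.
  apply/seteqP; split => [x Ax|x [p _]]; last first.
    by rewrite /F; case: ifPn => // /asboolP; apply.
  have [e e0 eA] : exists2 e : R, 0 < e &
      forall y : 'rV[R]_n, (forall i, `|x 0 i - y 0 i| < e) -> A y.
    by apply/nbhs_rVP; exact: oA.
  have e20 : 0 < e / 2 by rewrite divr_gt0.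
  have [k ke] : exists k, k.+1%:R^-1 < e / 2.
    exists (Num.truncn (e / 2)^-1); rewrite invf_plt ?posrE//.
    exact: truncnS_gt.
  have k0 : 0 < k.+1%:R^-1 :> R by rewrite invr_gt0.
  have qP i : exists q : rat, `|ratr q - x 0 i| < k.+1%:R^-1.
    have [q] : exists q : rat, ratr q \in `](x 0 i), (x 0 i + k.+1%:R^-1)[.
      by apply: rat_in_itvoo; rewrite ltrDl.
    rewrite in_itv/= => /andP[h1 h2]; exists q.
    by rewrite ltr_distl h2 andbT (lt_trans _ h1)// ltrBlDr ltrDl.
  exists (\row_i sval (cid (qP i)), k) => //.
  have boxx : box (\row_i sval (cid (qP i)), k) x.
    by move=> i; rewrite /ball/= !mxE; case: cid.
  rewrite /F; case: asboolP => // -[] y /= yb; apply: eA => i.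
  have := boxx i; have := yb i; rewrite /ball/= mxE => h1 h2.
  rewrite distrC -(subrKA (ratr (sval (cid (qP i))))) (le_lt_trans (ler_normD _ _))//.
  by rewrite [e]splitr ltrD// (lt_trans _ ke)// distrC.
refine (@countable_bigcupT_measurable _ (borel_rV R n) _ F _ _) => [|p].
  exact: countableP.
rewrite /F; case: asboolP => // _.
refine (@measurable_box R n
  (fun i => ball (ratr (p.1 0 i) : R) p.2.+1%:R^-1) _) => i.
apply: measurable_realfun.open_measurable.
exact: ball_open.
Qed.

Lemma closed_measurable_rV (R : realType) n (A : set 'rV[R]_n) :
  closed A -> measurable (A : set (borel_rV R n)).
Proof.
move=> cA; rewrite -[A]setCK; apply: measurableC; apply: open_measurable_rV.
by rewrite openC.
Qed.

(** * Borel sets and Tonelli's theorem on R^n *)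

Section transfer.
Context (R : realType) (n : nat).
Local Notation lam := (borel_lebesgue R n).
Local Notation mu := (lebesgue_rV R n).
Local Notation C := (caratheodory_type (lam^*)%mu).

Lemma measurable_id_rV : measurable_fun [set: C] (id : C -> borel_rV R n).
Proof.
move=> _ A mA; rewrite setTI preimage_id.
exact: caratheodory_measurable_mu_ext.
Qed.

Lemma measurable_lebesgue_rV (A : set 'rV[R]_n) :
  measurable (A : set (borel_rV R n)) -> measurable (A : set C).
Proof. exact: caratheodory_measurable_mu_ext. Qed.

Lemma measurable_fun_lebesgue_rV d (T : measurableType d) (D : set 'rV[R]_n)
    (f : 'rV[R]_n -> T) :
  measurable (D : set (borel_rV R n)) ->
  measurable_fun (D : set (borel_rV R n)) (f : borel_rV R n -> T) ->
  measurable_fun (D : set C) (f : C -> T).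
Proof. by move=> mD mf _ A mA; apply: measurable_lebesgue_rV; exact: mf. Qed.

Lemma ge0_integral_lebesgue_rV (D : set (borel_rV R n))
    (f : borel_rV R n -> \bar R) :
  measurable D -> measurable_fun D f -> {in D, forall x, 0 <= f x}%E ->
  (\int[mu]_(x in D) f x = \int[lam]_(x in D) f x)%E.
Proof.
move=> mD mf f0.
rewrite -[LHS](@ge0_integral_pushforward _ _ _ _ _ _ measurable_id_rV mu)//.
apply: eq_measure_integral => [|mid A mA _]; first exact: measurable_id_rV.
exact: (lebesgue_rV_borel mA).
Qed.

End transfer.

Section tonelli.
Context (R : realType).
Local Open Scope ereal_scope.
Local Notation lam := (borel_lebesgue R).

Lemma integral_cons_rV n (f : borel_rV R n.+1 -> \bar R) :
  measurable_fun setT f -> (forall x, 0 <= f x) ->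
  \int[lam n.+1]_x f x = \int[lebesgue_measure]_t \int[lam n]_x f (cons_rV (t, x)).
Proof.
move=> mf f0.
transitivity (\int[lebesgue_measure \x lam n]_p (f \o @cons_rV R n) p).
  rewrite -[RHS](@ge0_integral_pushforward _ _ _ _ _ _
    (@measurable_cons_rV R n) _ setT f)//.
rewrite fubini_tonelli1//.
  by apply: measurableT_comp => //; exact: measurable_cons_rV.
by move=> x; exact: f0.
Qed.

Lemma measurable_row_mx n m :
  measurable_fun setT
   (fun p : borel_rV R n * borel_rV R m =>
     row_mx (p.1 : 'rV[R]_n) (p.2 : 'rV[R]_m) : borel_rV R (n + m)).
Proof.
apply: measurable_fun_rV => i; case: (split_ordP i) => j ->.
- rewrite [X in measurable_fun _ X](_ : _ =
    (fun x : borel_rV R n => (x : 'rV[R]_n) ord0 j) \o fst).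
    by apply: measurableT_comp => //; exact: measurable_coord.
  by apply/funext => p /=; rewrite row_mxEl.
- rewrite [X in measurable_fun _ X](_ : _ =
    (fun x : borel_rV R m => (x : 'rV[R]_m) ord0 j) \o snd).
    by apply: measurableT_comp => //; exact: measurable_coord.
  by apply/funext => p /=; rewrite row_mxEr.
Qed.

Lemma cons_row_mx n m (t : R) (x : 'rV[R]_n) (y : 'rV[R]_m) :
  (cons_rV (t, row_mx x y) : 'rV[R]_(n + m).+1) =
  row_mx (cons_rV (t, x) : 'rV[R]_n.+1) y.
Proof.
apply/rowP => i; rewrite [LHS]mxE; case: (@split_ordP n.+1 m i) => j ->.
- rewrite (@row_mxEl _ 1 n.+1 m) mxE; case: (unliftP ord0 j) => [k ->|->].
    have -> : lshift m (lift ord0 k) = lift ord0 (lshift m (k : 'I_n)) :> 'I_(n + m).+1.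
      exact: val_inj.
    by rewrite !liftK /= row_mxEl.
  have -> : lshift m ord0 = ord0 :> 'I_(n + m).+1 by exact: val_inj.
  by rewrite !unlift_none.
- have -> : rshift n.+1 j = lift ord0 (rshift n j) :> 'I_(n + m).+1.
    exact: val_inj.
  rewrite liftK /= row_mxEr -(@row_mxEr _ 1 n.+1 m (cons_rV (t, x) : 'rV_n.+1)).
  by congr (row_mx _ _ _ _); exact: val_inj.
Qed.

Lemma integral_row_mx n m (f : borel_rV R (n + m) -> \bar R) :
  measurable_fun setT f -> (forall x, 0 <= f x) ->
  \int[lam (n + m)%N]_x f x =
  \int[lam n]_x \int[lam m]_y f (row_mx (x : 'rV[R]_n) (y : 'rV[R]_m)).
Proof.
elim: n f => [|n IH] f mf f0.
  have mF : measurable_fun setT (fun x : borel_rV R 0 =>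
      \int[lam m]_y f (row_mx (x : 'rV[R]_0) (y : 'rV[R]_m))).
    apply: (@measurable_fun_fubini_tonelli_F _ _ (borel_rV R 0) (borel_rV R m)
      _ (lam m) (fun p => f (row_mx (p.1 : 'rV[R]_0) (p.2 : 'rV[R]_m)))) => //.
    exact: (measurableT_comp mf (@measurable_row_mx 0 m)).
  rewrite [RHS]integral_dirac// diracT mul1e; apply: eq_integral => y _.
  congr f; apply/rowP => i; case: (@split_ordP 0 m i) => j ->; first by case: j.
  by rewrite row_mxEr; congr (y _ _); exact: val_inj.
rewrite [LHS]integral_cons_rV// [RHS]integral_cons_rV//.
- apply: eq_integral => t _; rewrite IH//; last first.
    apply: measurableT_comp => //.
    by apply: (measurableT_comp (@measurable_cons_rV R (n + m))).
  apply: eq_integral => x _; apply: eq_integral => y _.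
  by rewrite cons_row_mx.
- apply: (@measurable_fun_fubini_tonelli_F _ _ (borel_rV R n.+1) (borel_rV R m)
    _ (lam m) (fun p => f (row_mx (p.1 : 'rV[R]_n.+1) (p.2 : 'rV[R]_m)))) => //.
  exact: (measurableT_comp mf (@measurable_row_mx n.+1 m)).
- by move=> x; exact: integral_ge0.
Qed.

End tonelli.

(** * Diagonal changes of variables and product integrands *)

Section lebesgue_scaling.
Context (R : realType).
Local Open Scope ereal_scope.
Local Notation leb := (@lebesgue_measure R).

Lemma lebesgue_measureZ (a : R) (A : set (measurableTypeR R)) : a != 0%R ->
  measurable A ->
  (`|a|%:E * leb ((fun t => a * t)%R @^-1` A) = leb A)%E.
Proof.
move=> a0 mA.
have a0' : (0 < `|a|)%R by rewrite normr_gt0.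
have ma : measurable_fun [set: measurableTypeR R]
    (fun t : measurableTypeR R => (a * t)%R : measurableTypeR R).
  exact: mulrl_measurable.
apply/esym.
pose a1 : {nonneg R} := NngNum (normr_ge0 a).
rewrite (@lebesgue_measure_unique R (mscale a1 (pushforward leb
  (fun t : measurableTypeR R => (a * t)%R : measurableTypeR R))))//.
move=> _ [[x y] _ <-]; rewrite -[RHS]/((`|a|%R)%:E *
  leb ((fun t => a * t)%R @^-1` `]x, y]%classic)).
have /orP[a_lt0|a_gt0] := lt_total a0.
- rewrite (_ : _ @^-1` _ = `[(y / a)%R, (x / a)%R[%classic).
    rewrite !lebesgue_measure_itv/= !lte_fin ltr_ndivrMr// divfK//.
    case: ifPn => xy; rewrite ?mule0// -EFinB ltr0_norm// -EFinM.
    by congr EFin; field.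
  apply/seteqP; split=> t /=; rewrite !in_itv/= ler_ndivrMr// ltr_ndivlMr//.
    by rewrite mulrC => /andP[-> ->].
  by rewrite mulrC => /andP[-> ->].
- rewrite (_ : _ @^-1` _ = `](x / a)%R, (y / a)%R]%classic).
    rewrite !lebesgue_measure_itv/= !lte_fin ltr_pdivrMr// divfK//.
    case: ifPn => xy; rewrite ?mule0// -EFinB gtr0_norm// -EFinM.
    by congr EFin; field.
  by apply/seteqP; split=> t /=; rewrite !in_itv/= ltr_pdivrMr// ler_pdivlMr// mulrC.
Qed.

Lemma ge0_integralZ_lebesgue (a : R) (f : R -> \bar R) : a != 0%R ->
  measurable_fun (setT : set R) f -> (forall t, 0 <= f t) ->
  \int[leb]_t f (a * t)%R = `|a|^-1%:E * \int[leb]_t f t.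
Proof.
move=> a0 mf f0.
have ma : measurable_fun [set: measurableTypeR R]
    (fun t : measurableTypeR R => (a * t)%R : measurableTypeR R).
  exact: mulrl_measurable.
have a0' : (0 <= `|a|^-1)%R by rewrite invr_ge0.
rewrite -[LHS](@ge0_integral_pushforward _ _ _ _ _ _ ma leb setT f)//.
rewrite -[`|a|^-1%:E]/((NngNum a0')%:num%:E) -ge0_integral_mscale//.
apply: eq_measure_integral => A mA _.
rewrite -[RHS]/(_ * leb A) -[leb A in RHS](lebesgue_measureZ a0 mA) muleA -EFinM.
by rewrite mulVf ?mul1e// normr_eq0.
Qed.

End lebesgue_scaling.

Section diagonal_scaling.
Context (R : realType).
Local Open Scope ereal_scope.
Local Notation lam := (borel_lebesgue R).

Definition diag_scale n (a : 'I_n -> R) (x : 'rV[R]_n) : 'rV[R]_n :=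
  (\row_i (a i * x 0 i))%R.

Lemma measurable_diag_scale n (a : 'I_n -> R) :
  measurable_fun setT (diag_scale a : borel_rV R n -> borel_rV R n).
Proof.
apply: measurable_fun_rV => i.
rewrite [X in measurable_fun _ X](_ : _ =
    (fun x : borel_rV R n => (a i * (x : 'rV[R]_n) ord0 i)%R)).
  by apply: measurable_funM => //; exact: measurable_coord.
by apply/funext => x; rewrite mxE.
Qed.

Lemma ge0_integral_diag_scale n (a : 'I_n -> R) (f : borel_rV R n -> \bar R) :
  (forall i, a i != 0%R) ->
  measurable_fun setT f -> (forall x, 0 <= f x) ->
  \int[lam n]_x f (diag_scale a x) =
  (\prod_(i < n) `|a i|^-1)%R%:E * \int[lam n]_x f x.
Proof.
elim: n a f => [|n IH] a f a0 mf f0.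
  rewrite big_ord0 mul1e; apply: eq_integral => x _; congr f.
  by apply/rowP => -[].
rewrite [in LHS]integral_cons_rV//; last first.
  exact: measurableT_comp mf (@measurable_diag_scale _ a).
pose G t := \int[lam n]_x f (cons_rV (t, x)).
have mG : measurable_fun (setT : set R) G.
  apply: (@measurable_fun_fubini_tonelli_F _ _ R (borel_rV R n) _ (lam n)
    (fun p => f (cons_rV p))) => //.
  exact: measurableT_comp mf (@measurable_cons_rV R n).
have G0 t : 0 <= G t by exact: integral_ge0.
have mft (t : R) : measurable_fun setT (fun x : borel_rV R n => f (cons_rV (t, x))).
  apply: measurableT_comp mf _.
  by apply: (measurableT_comp (@measurable_cons_rV R n)).
under eq_integral => t _.
  rewrite (eq_integral (fun x : borel_rV R n => f (cons_rV ((a ord0 * t)%R,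
    diag_scale (fun i => a (lift ord0 i)) x)))); last first.
    move=> x _; congr f; apply/rowP => i; rewrite !mxE.
    by case: (unliftP ord0 i) => [j ->|->] /=; rewrite ?mxE.
  rewrite (IH _ (fun y => f (cons_rV ((a ord0 * t)%R, y))))// -/(G (a ord0 * t)%R).
  over.
rewrite /= ge0_integralZl//; last 2 first.
- by apply: measurableT_comp => //; exact: mulrl_measurable.
- by rewrite lee_fin prodr_ge0// => i _; rewrite invr_ge0.
rewrite ge0_integralZ_lebesgue// big_ord_recl EFinM muleCA muleA.
by congr (_ * _); rewrite [RHS]integral_cons_rV.
Qed.

Lemma ge0_integral_scale n (c : R) (f : borel_rV R n -> \bar R) :
  c != 0%R -> measurable_fun setT f -> (forall x, 0 <= f x) ->
  \int[lam n]_x f (c *: (x : 'rV[R]_n))%R =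
  (`|c|^-1 ^+ n)%R%:E * \int[lam n]_x f x.
Proof.
move=> c0 mf f0.
rewrite (_ : (`|c|^-1 ^+ n = \prod_(i < n) `|c|^-1)%R); last first.
  by rewrite prodr_const card_ord.
rewrite -(@ge0_integral_diag_scale _ (fun=> c))//.
by apply: eq_integral => x _; congr f; apply/rowP => i; rewrite !mxE.
Qed.

Lemma integral_flip n (a : 'I_n -> R) (f : borel_rV R n -> \bar R) :
  (forall i, `|a i|%R = 1%R) -> measurable_fun setT f ->
  \int[lam n]_x f (diag_scale a x) = \int[lam n]_x f x.
Proof.
move=> a1 mf.
have a0 i : a i != 0%R by rewrite -normr_eq0 a1 oner_eq0.
have P1 : (\prod_(i < n) `|a i|^-1 = 1)%R.
  by rewrite big1// => i _; rewrite a1 invr1.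
rewrite integralE [RHS]integralE; congr (_ - _).
- have := ge0_integral_diag_scale a0 (measurable_funepos mf).
  rewrite P1 mul1e => <- //; apply: eq_integral => x _.
  by rewrite !funeposE.
- have := ge0_integral_diag_scale a0 (measurable_funeneg mf).
  rewrite P1 mul1e => <- //; apply: eq_integral => x _.
  by rewrite !funenegE.
Qed.

End diagonal_scaling.

Section product_integral.
Context (R : realType).
Local Open Scope ereal_scope.
Local Notation lam := (borel_lebesgue R).

Lemma measurable_prod_coord n (h : 'I_n -> R -> R) :
  (forall i, measurable_fun setT (h i)) ->
  measurable_fun setT (fun x : borel_rV R n =>
    (\prod_(i < n) h i ((x : 'rV[R]_n) ord0 i))%R).
Proof.
move=> mh; apply: measurable_prod => i _.
by apply: measurableT_comp => //; exact: measurable_coord.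
Qed.

Lemma integral_prod_coord n (h : 'I_n -> R -> R) :
  (forall i, measurable_fun setT (h i)) -> (forall i t, (0 <= h i t)%R) ->
  \int[lam n]_x (\prod_(i < n) h i ((x : 'rV[R]_n) ord0 i))%R%:E =
  \prod_(i < n) \int[lebesgue_measure]_t (h i t)%:E.
Proof.
elim: n h => [|n IH] h mh h0.
  rewrite big_ord0; under eq_integral do rewrite big_ord0.
  by rewrite integral_dirac// diracT mul1e.
rewrite integral_cons_rV//; last 2 first.
- by apply/measurable_EFinP; exact: measurable_prod_coord.
- by move=> x; rewrite lee_fin prodr_ge0.
under eq_integral => t _.
  under eq_integral => x _.
    rewrite big_ord_recl EFinM {1}/cons_rV mxE unlift_none /=.
    under eq_bigr do rewrite mxE liftK /=.
    over.
  rewrite ge0_integralZl//; last 3 first.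
  - apply/measurable_EFinP.
    exact: (@measurable_prod_coord n (fun i => h (lift ord0 i))).
  - by move=> x _; rewrite lee_fin prodr_ge0.
  - by rewrite lee_fin; exact: h0.
  rewrite (IH (fun i => h (lift ord0 i)))//.
  over.
rewrite ge0_integralZr//; last 3 first.
- by apply/measurable_EFinP; exact: mh.
- by move=> x _; rewrite lee_fin; exact: h0.
- by apply: prode_ge0 => i _; apply: integral_ge0 => t _; rewrite lee_fin; exact: h0.
by rewrite big_ord_recl.
Qed.

End product_integral.

Section Rintegral_rV.
Context (R : realType) (n : nat).
Local Notation lam := (borel_lebesgue R n).
Local Notation mu := (lebesgue_rV R n).

Lemma Rintegral_lebesgue_rV (D : set (borel_rV R n)) (f : borel_rV R n -> R) :
  measurable D -> measurable_fun D f ->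
  \int[mu]_(x in D) f x = \int[lam]_(x in D) f x.
Proof.
move=> mD /measurable_EFinP mf; rewrite /Rintegral; congr fine.
rewrite integralE [RHS]integralE; congr (_ - _)%E.
- by apply: ge0_integral_lebesgue_rV => //; exact: measurable_funepos.
- by apply: ge0_integral_lebesgue_rV => //; exact: measurable_funeneg.
Qed.

Lemma Rintegral_odd (a : 'I_n -> R) (D : set (borel_rV R n))
    (f : borel_rV R n -> R) :
  (forall i, `|a i| = 1) -> measurable D -> measurable_fun setT f ->
  (forall x, D (diag_scale a x) <-> D x) ->
  (forall x, f (diag_scale a x) = - f x) ->
  \int[lam]_(x in D) f x = 0.
Proof.
move=> a1 mD mf Da fa; rewrite Rintegral_mkcond /Rintegral.
set g := f \_ D.
have mg : measurable_fun setT (EFin \o g).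
  apply/measurable_EFinP/measurable_restrict => //.
  exact: measurable_funTS.
have ga x : g (diag_scale a x) = - g x.
  rewrite /g !patchE fa (_ : (diag_scale a x \in D) = (x \in D)).
    by case: ifPn => //; rewrite oppr0.
  by apply/idP/idP => /set_mem/Da/mem_set.
rewrite integralE.
have <- : (\int[lam]_x (EFin \o g)^\+ x = \int[lam]_x (EFin \o g)^\- x)%E.
  rewrite -(integral_flip a1 (measurable_funepos mg)).
  by apply: eq_integral => x _; rewrite funeposE funenegE/= ga.
by case: (\int[lam]_x _)%E => //= r; rewrite subrr.
Qed.

End Rintegral_rV.

(** * Cubes and indicator functions *)

Section box.
Context (R : realType).
Lemma integral_sqr (r : R) : 0 <= r ->
  (\int[lebesgue_measure]_(t in `[(- r)%R, r]) (t ^+ 2)%:E =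
  (2 * r * (r ^+ 2 / 3))%:E)%E.
Proof.
rewrite le_eqVlt => /orP[/eqP <-|r0].
  by rewrite oppr0 set_itv1 integral_set1 mulr0 mul0r.
have rr : - r < r by lra.
pose F : R -> R := (3^-1 \*: (@id R ^+ 3)).
have dF x : is_derive (x : R) 1 F (x ^+ 2).
  apply: is_derive_eq => //. by rewrite /GRing.scale/=; field.
have cF (x : R) : F t @[t --> x] --> F x.
  by apply/differentiable_continuous/derivable1_diffP; exact: ex_derive.
rewrite (@continuous_FTC2 _ _ F)//.
- rewrite -EFinB; congr EFin; rewrite -[F r]/(3^-1 * (r * (r * r))).
  by rewrite -[F (- r)]/(3^-1 * (- r * (- r * - r))); field.
- apply: continuous_subspaceT => t; exact: exprn_continuous.
- split => [x _||]; first exact: ex_derive.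
  + exact: cvg_at_right_filter.
  + exact: cvg_at_left_filter.
- by move=> x _; rewrite derive1E derive_val.
Qed.

Local Notation lam := (borel_lebesgue R).

Definition box n (r : R) : set 'rV[R]_n := [set x | forall i, - r <= x 0 i <= r].
Arguments box : clear implicits.

Lemma measurable_symbox n (r : R) : measurable (box n r : set (borel_rV R n)).
Proof.
exact: (@measurable_box R n (fun=> [set` `[(- r), r]])).
Qed.

Lemma symbox_lt0 n (r : R) : (0 < n)%N -> r < 0 -> box n r = set0.
Proof.
case: n => // n _ r0; apply/seteqP; split => // x /(_ ord0) /andP[h1 h2].
by have := le_trans h1 h2; rewrite leNgt => /negP; apply; lra.
Qed.

Lemma indic_symbox n (r : R) (x : 'rV[R]_n) :
  \1_(box n r) x = \prod_(i < n) \1_(`[(- r), r]%classic) (x 0 i) :> R.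
Proof.
have [xB|/existsNP[i xi]] := pselect (forall i, - r <= x 0 i <= r).
  rewrite indicE mem_set//= big1// => i _.
  by rewrite indicE mem_set//= in_itv/= xB.
rewrite indicE memNset/=; last by move=> /(_ i).
by rewrite (bigD1 i)//= indicE memNset ?mul0r//= in_itv/=.
Qed.

Lemma vol_symbox n (r : R) : 0 <= r ->
  lam n (box n r) = ((2 * r) ^+ n)%:E.
Proof.
move=> r0; rewrite (@borel_lebesgue_box R n (fun=> [set` `[(- r), r]]))//.
rewrite (eq_bigr (fun=> (2 * r)%:E)) => [|i _].
  by rewrite prodEFin prodr_const card_ord.
rewrite lebesgue_measure_itv/= lte_fin; case: ifPn => h.
  by rewrite -EFinB; congr EFin; ring.
by congr EFin; lra.
Qed.

Lemma integral_symbox_sqr n (r : R) (j : 'I_n) : 0 <= r ->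
  (\int[lam n]_(x in box n r) ((x : 'rV[R]_n) 0 j ^+ 2)%:E =
   ((2 * r) ^+ n * (r ^+ 2 / 3))%:E)%E.
Proof.
move=> r0.
pose h (i : 'I_n) (t : R) : R :=
  \1_(`[(- r), r]%classic) t * (if i == j then t ^+ 2 else 1).
have h0 i t : 0 <= h i t.
  by apply: mulr_ge0; [rewrite indicE|case: ifPn => _ //; exact: sqr_ge0].
have mh i : measurable_fun setT (h i).
  apply: measurable_funM; first exact: measurable_indic.
  by case: (i == j) => //; exact: exprn_measurable.
rewrite integral_mkcond.
transitivity (\int[lam n]_x (\prod_(i < n) h i ((x : 'rV[R]_n) ord0 i))%:E)%E.
  apply: eq_integral => x _.
  rewrite restrict_EFin/= patch_indic/=; congr EFin.
  rewrite big_split/= -indic_symbox mulrC; congr (_ * _).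
  by rewrite (bigD1 j)//= eqxx big1 ?mulr1// => i /negbTE ->.
rewrite integral_prod_coord// (bigD1 j)//=.
have -> : (\int[lebesgue_measure]_t (h j t)%:E = (2 * r * (r ^+ 2 / 3))%:E)%E.
  rewrite -integral_sqr// [RHS]integral_mkcond; apply: eq_integral => t _.
  by rewrite restrict_EFin/= patch_indic/= /h eqxx mulrC.
rewrite (eq_bigr (fun=> (2 * r)%:E)) => [|i ij].
  rewrite prodEFin -EFinM prodr_const (_ : #|_| = n.-1); last first.
    by rewrite cardC1 card_ord.
  case: n j {h h0 mh} => [[]//|n] j.
  by rewrite /= [(2 * r) ^+ n.+1]exprS; congr EFin; ring.
transitivity (\int[lebesgue_measure]_t (\1_(`[(- r), r]%classic) t)%:E)%E.
  by apply: eq_integral => t _; rewrite /h (negbTE ij) mulr1.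
rewrite integral_indic// setIT -[LHS]/(lebesgue_measure `[(- r), r]%classic).
rewrite lebesgue_measure_itv/= lte_fin; case: ifPn => h'.
  by rewrite -EFinB; congr EFin; ring.
by congr EFin; lra.
Qed.

End box.
Arguments box : clear implicits.

Section indicator.
Context (R : realType).
Local Notation lam := (borel_lebesgue R).

Lemma barycenter_sym0 n (K : set 'rV[R]_n) :
  measurable (K : set (borel_rV R n)) -> centrally_symmetric K ->
  barycenter K = 0.
Proof.
move=> mK sK; apply/rowP => i; rewrite !mxE Rintegral_lebesgue_rV//; last first.
  exact: measurable_funTS (@measurable_coord R n i).
rewrite (@Rintegral_odd _ _ (fun=> -1))// ?mulr0//.
- by move=> _; rewrite normrN1.
- exact: measurable_coord.
- move=> x; rewrite (_ : diag_scale _ x = - x).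
    rewrite [in X in X <-> _]sK; split; first by move=> [y Ky /oppr_inj <-].
    by exists x.
  by apply/rowP => k; rewrite !mxE mulN1r.
- by move=> x; rewrite mxE mulN1r.
Qed.

Lemma isotropic_constant_fun_indic n (K : set 'rV[R]_n) :
  measurable (K : set (borel_rV R n)) ->
  isotropic_constant_fun (\1_K : 'rV[R]_n -> R) = isotropic_constant K.
Proof.
move=> mK.
have IE (h : 'rV[R]_n -> R) :
    \int[lebesgue_rV R n]_x (h x * \1_K x) = \int[lebesgue_rV R n]_(x in K) h x.
  rewrite [RHS]Rintegral_mkcond; apply: eq_Rintegral => x _.
  by rewrite patch_indic.
have mE : mass (\1_K : 'rV[R]_n -> R) = vol K.
  rewrite /mass /Rintegral integral_indic// ?setIT//.
  exact: measurable_lebesgue_rV.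
have bE : barycenter_fun (\1_K : 'rV[R]_n -> R) = barycenter K.
  by apply/rowP => i; rewrite !mxE mE mulrC IE.
have cE : covariance_mx_fun (\1_K : 'rV[R]_n -> R) = covariance_mx K.
  by rewrite /covariance_mx_fun bE; congr (_ - _); apply/matrixP => i j;
    rewrite !mxE mE mulrC IE.
have eE : entropy (\1_K : 'rV[R]_n -> R) = 0.
  rewrite /entropy (_ : (fun x => _) = cst 0).
    by rewrite Rintegral_cst//= mul0r mul0r oppr0.
  apply/funext => x; rewrite indicE; case: (x \in K) => /=.
    by rewrite ln1 mulr0.
  by rewrite mul0r.
rewrite /isotropic_constant_fun /isotropic_constant cE eE oppr0 expR0 mE mul1r mulrC.
congr (_ * _).
rewrite -powR_inv1 ?fine_ge0 ?measure_ge0//.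
by rewrite -powRrM mulN1r powRN.
Qed.

Lemma covariance_cube d : covariance_mx (cube R d) = (3^-1)%:M.
Proof.
have mC : measurable (cube R d : set (borel_rV R d)) by exact: measurable_symbox.
have volC : vol (cube R d) = 2 ^+ d.
  by rewrite /vol lebesgue_rV_borel// (@vol_symbox R d 1)//= mulr1.
have sC : centrally_symmetric (cube R d).
  apply/seteqP; split=> [x xC|_ [y yC <-] i].
    exists (- x); last by rewrite opprK.
    by move=> i; have := xC i; rewrite mxE; lra.
  by have := yC i; rewrite mxE; lra.
rewrite /covariance_mx barycenter_sym0// mulmx0 subr0.
apply/matrixP => i j; rewrite !mxE volC.
rewrite Rintegral_lebesgue_rV//; last first.
  apply: measurable_funTS; apply: measurable_funM; exact: measurable_coord.
have [<-|ij] := eqVneq i j.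
  rewrite /Rintegral (_ : (\int[_]_(x in _) _)%E =
    (\int[lam d]_(x in box R d 1) ((x : 'rV[R]_d) 0 i ^+ 2)%:E)%E)//.
  by rewrite integral_symbox_sqr//= mulr1 expr1n mul1r mulrA mulVf ?mul1r//.
rewrite (@Rintegral_odd _ _ (fun k => if k == i then -1 else 1)) ?mulr0//.
- by move=> k; case: ifP; rewrite ?normrN1 ?normr1.
- apply: measurable_funM; exact: measurable_coord.
- move=> x; split => xC k; have := xC k; rewrite mxE; case: ifP => _; lra.
- by move=> x; rewrite !mxE eqxx eq_sym (negbTE ij); ring.
Qed.

Lemma isotropic_constant_cube d : (0 < d)%N ->
  isotropic_constant (cube R d) = 1 / Num.sqrt 12.
Proof.
move=> d0.
have volC : vol (cube R d) = 2 ^+ d.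
  rewrite /vol lebesgue_rV_borel ?(@vol_symbox R d 1)//= ?mulr1//.
  exact: measurable_symbox.
have d0' : d%:R != 0 :> R by rewrite pnatr_eq0 -lt0n.
rewrite /isotropic_constant covariance_cube det_scalar volC.
rewrite -!powR_mulrn// -!powRrM mulfV// powRr1//.
rewrite (_ : d%:R * (2 * d%:R)^-1 = 2^-1); last by field.
rewrite -sqrtrV ?powR12_sqrt// mul1r.
rewrite (_ : 12^-1 = 3^-1 * 2^-1 ^+ 2 :> R); last by field.
by rewrite sqrtrM ?invr_ge0// sqrtr_sqr ger0_norm ?invr_ge0.
Qed.

Lemma interior_box n (K : set 'rV[R]_n) (x : 'rV[R]_n) : K° x ->
  exists2 e : R, 0 < e & forall y : 'rV[R]_n,
    (forall i, `|x 0 i - y 0 i| <= e) -> K y.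
Proof.
move=> /nbhs_rVP[e e0 eK]; exists (e / 2); first by rewrite divr_gt0.
move=> y xy; apply: eK => i; apply: le_lt_trans (xy i) _.
by rewrite ltr_pdivrMr// ltr_pMr// ltr1n.
Qed.

Lemma compact_bounded_rV n (K : set 'rV[R]_n) : compact K ->
  exists2 M : R, 0 < M & K `<=` box R n M.
Proof.
move=> /compact_bounded[M [_ MK]].
exists (`|M| + 1); first by rewrite ltr_wpDl.
move=> x Kx i; rewrite -ler_norml.
have : `|x| <= `|M| + 1 by apply: MK => //; rewrite (le_lt_trans (ler_norm _))// ltrDl.
apply: le_trans; rewrite [leRHS]/Num.norm/= mx_normrE.
by apply/bigmax_geP; right; exists (0, i).
Qed.

Lemma compact_measurable_rV n (K : set 'rV[R]_n) : compact K ->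
  measurable (K : set (borel_rV R n)).
Proof.
have hT : hausdorff_space 'rV[R]_n by exact: norm_hausdorff.
by move=> cK; exact: closed_measurable_rV (compact_closed hT cK).
Qed.

Lemma compact_lebesgue_lty n (K : set 'rV[R]_n) : compact K ->
  (lam n K < +oo)%E.
Proof.
move=> cK; have [M M0 KM] := compact_bounded_rV cK.
rewrite (@le_lt_trans _ _ (lam n (box R n M)))//.
  apply: le_measure => //; rewrite inE; last exact: measurable_symbox.
  exact: compact_measurable_rV.
by rewrite vol_symbox ?ltry// ltW.
Qed.

Lemma interior_lebesgue_gt0 n (K : set 'rV[R]_n) :
  measurable (K : set (borel_rV R n)) -> K° !=set0 -> (0 < lam n K)%E.
Proof.
move=> mK [x /interior_box[e e0 eK]].
pose B := [set y : 'rV[R]_n | forall i, `[(x 0 i - e), (x 0 i + e)]%classic (y 0 i)].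
have mB : measurable (B : set (borel_rV R n)).
  exact: (@measurable_box R n (fun i => [set` `[(x 0 i - e), (x 0 i + e)]])).
rewrite (@lt_le_trans _ _ (lam n B))//.
  rewrite (@borel_lebesgue_box R n
    (fun i => [set` `[(x 0 i - e), (x 0 i + e)]]))//.
  rewrite (eq_bigr (fun=> (2 * e)%:E)) => [|i _].
    by rewrite prodEFin lte_fin prodr_const exprn_gt0// mulr_gt0.
  rewrite lebesgue_measure_itv/= lte_fin ifT; last by lra.
  by rewrite -EFinB; congr EFin; ring.
apply: le_measure; rewrite ?inE// => y By; apply: eK => i.
have := By i; rewrite /= in_itv/= ler_distlC; lra.
Qed.

Lemma convex_setP n (K : set 'rV[R]_n) : convex_set K <->
  forall x y (t : R), 0 <= t <= 1 -> K x -> K y -> K (t *: x + (1 - t) *: y).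
Proof.
split => [cK x y t t01 Kx Ky|cK x y t /set_mem Kx /set_mem Ky]; last first.
  by apply/mem_set; apply: cK => //; exact/andP.
have := cK x y (Itv01 (proj1 (andP t01)) (proj2 (andP t01))) (mem_set Kx) (mem_set Ky).
by move/set_mem.
Qed.

Lemma log_concave_indic n (K : set 'rV[R]_n) :
  convex_set K -> log_concave (\1_K : 'rV[R]_n -> R).
Proof.
move=> /convex_setP cK.
exists (fun x => if x \in K then 0%E else +oo%E); split.
- by move=> x; case: ifP.
- move=> x y t t01; have /andP[t0 t1] := t01.
  have t1' : 0 <= 1 - t by lra.
  have [->|tn0] := eqVneq t 0.
    by rewrite scale0r add0r subr0 scale1r mul0e add0e mul1e.
  have [->|tn1] := eqVneq t 1.
    by rewrite subrr scale0r addr0 scale1r mul0e adde0 mul1e.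
  have tp : 0 < t by rewrite lt_neqAle eq_sym tn0.
  have tp1 : 0 < 1 - t by rewrite subr_gt0 lt_neqAle tn1.
  have ty : (t%:E * +oo = +oo)%E by rewrite gt0_muley ?lte_fin.
  have ty1 : ((1 - t)%:E * +oo = +oo)%E by rewrite gt0_muley ?lte_fin.
  have [xK|xK] := boolP (x \in K); last first.
    by rewrite ty; case: (y \in K); rewrite ?ty1 ?mule0 ?adde0 ?addey// leey.
  have [yK|yK] := boolP (y \in K); last by rewrite ty1 mule0 add0e leey.
  rewrite mem_set ?mule0 ?adde0//; apply: cK => //; exact/set_mem.
- move=> x; rewrite indicE; case: ifP => _ /=.
    by rewrite oppr0 expR0.
  by [].
Qed.

Lemma indic_even n (K : set 'rV[R]_n) : centrally_symmetric K ->
  even_fun (\1_K : 'rV[R]_n -> R).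
Proof.
move=> sK x; rewrite !indicE; congr (nat_of_bool _)%:R.
apply/idP/idP => /set_mem Kx; apply/mem_set.
  by move: Kx; rewrite {1}sK => -[y Ky /oppr_inj <-].
by rewrite sK; exists x.
Qed.

Lemma integrable_indic_rV n (K : set 'rV[R]_n) : compact K ->
  integrable_rV (\1_K : 'rV[R]_n -> R).
Proof.
move=> cK; have mK := compact_measurable_rV cK.
have cmK := measurable_lebesgue_rV mK.
have oo := compact_lebesgue_lty cK.
apply/integrableP; split; first by apply/measurable_EFinP; exact: measurable_indic.
under eq_integral do rewrite gee0_abs ?lee_fin//.
by rewrite integral_indic// setIT; move: oo; rewrite -(lebesgue_rV_borel mK).
Qed.

End indicator.

Lemma isotropic_constant_le_of_functions (R : realType) (n : nat) (c : R) :
  (forall f : 'rV[R]_n -> R, log_concave f -> even_fun f -> integrable_rV f ->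
    0 < mass f -> isotropic_constant_fun f <= c) ->
  forall K : set 'rV[R]_n, convex_body K -> centrally_symmetric K ->
    isotropic_constant K <= c.
Proof.
move=> Lc K [cK coK iK] sK; have mK := compact_measurable_rV coK.
rewrite -isotropic_constant_fun_indic//; apply: Lc.
- exact: log_concave_indic.
- exact: indic_even.
- exact: integrable_indic_rV.
- rewrite /mass /Rintegral integral_indic//; last exact: measurable_lebesgue_rV.
  rewrite setIT; apply: fine_gt0.
  rewrite -[X in (0 < X < _)%E]/(lebesgue_rV R n K) lebesgue_rV_borel//.
  by rewrite interior_lebesgue_gt0// compact_lebesgue_lty.
Qed.

(** * Even log-concave functions *)

(* With [x `^ 0 = 1] also at [x = 0], the inequality is trivial at [t = 0] and
   [t = 1] even where [f] vanishes. *)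
Definition mult_concave (R : realType) n (f : 'rV[R]_n -> R) :=
  forall (x y : 'rV[R]_n) (t : R), 0 <= t <= 1 ->
    f x `^ t * f y `^ (1 - t) <= f (t *: x + (1 - t) *: y).

Section mult_concave.
Context (R : realType) (n : nat).
Implicit Types (f : 'rV[R]_n -> R) (x y : 'rV[R]_n).

Lemma log_concave_ge0 f x : log_concave f -> 0 <= f x.
Proof. by move=> [phi [_ _ fE]]; rewrite -lee_fin fE expeR_ge0. Qed.

Lemma log_concave_mult_concave f : log_concave f -> mult_concave f.
Proof.
move=> lf; have f0 x := log_concave_ge0 x lf.
case: lf => phi [phiNy phic fE] x y t /andP[t0 t1].
have [->|tn0] := eqVneq t 0.
  by rewrite powRr0 subr0 powRr1// scale0r add0r scale1r mul1r.
have [->|tn1] := eqVneq t 1.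
  by rewrite powRr1// subrr powRr0 scale0r addr0 scale1r mulr1.
have tp : 1 - t != 0 by rewrite subr_eq0 eq_sym.
have [fx0|fx0] := eqVneq (f x) 0; first by rewrite fx0 powR0// mul0r.
have [fy0|fy0] := eqVneq (f y) 0; first by rewrite fy0 powR0// mulr0.
have phiE z : f z != 0 -> exists2 a, phi z = a%:E & f z = expR (- a).
  move=> fz0; move: (fE z) (phiNy z) fz0; case: (phi z) => [a| |] //=.
    by move=> -[fz] _ _; exists a.
  by move=> -[->]; rewrite eqxx.
have [a pa ->] := phiE _ fx0; have [b pb ->] := phiE _ fy0.
have := phic x y t; rewrite t0 t1 => /(_ isT); rewrite pa pb.
have := fE (t *: x + (1 - t) *: y); have := phiNy (t *: x + (1 - t) *: y).
case: (phi _) => [c| |]//= _ -[->].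
rewrite -!EFinM -EFinD lee_fin => cab.
rewrite /powR !gt_eqF ?expR_gt0// !expRK -expRD ler_expR. lra.
Qed.

Context (f : 'rV[R]_n -> R).
Hypotheses (f0 : forall x, 0 <= f x) (fc : mult_concave f).

Lemma superlevel_convex (c t : R) x y : 0 <= c -> c <= f x -> c <= f y ->
  0 <= t <= 1 -> c <= f (t *: x + (1 - t) *: y).
Proof.
rewrite le_eqVlt => /orP[/eqP <-//|c0] cx cy t01; apply: le_trans (fc x y t01).
have /andP[t0 t1] := t01.
rewrite -[leLHS]powRr1; last exact: ltW.
rewrite -[X in _ `^ X](subrK t) addrC powRD; last by apply/implyP => _; rewrite gt_eqF.
by apply: ler_pM; rewrite ?powR_ge0//; apply: ge0_ler_powR;
  rewrite ?nnegrE ?subr_ge0// ltW.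
Qed.

Hypothesis (fe : even_fun f).

Lemma le_fun0 x : f x <= f 0.
Proof.
have -> : 0 = 2^-1 *: x + (1 - 2^-1) *: (- x).
  by rewrite (_ : 1 - 2^-1 = 2^-1 :> R) ?scalerN ?subrr//; field.
apply: superlevel_convex; rewrite ?fe//; lra.
Qed.

Lemma fun_shrink (t : R) x : 0 <= t <= 1 -> f x <= f (t *: x).
Proof.
move=> t01; have := superlevel_convex (f0 x) (lexx _) (le_fun0 x) t01.
by rewrite scaler0 addr0.
Qed.

Lemma superlevel_abs_sum (I : finType) (u : I -> R) (v : I -> 'rV[R]_n) (c : R) :
  0 <= c -> (forall i, c <= f (v i)) -> c <= f 0 ->
  \sum_i `|u i| <= 1 -> c <= f (\sum_i u i *: v i).
Proof.
move=> c0 cv cf0 u1.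
have [_ [w cw ->]] : 0 <= \sum_i `|u i| /\
    exists2 w, c <= f w & \sum_i u i *: v i = (\sum_i `|u i|) *: w.
  elim/big_ind2 : _ => [|x s y s' [s0 [w cw ->]] [s'0 [w' cw' ->]]|i _].
  - by split => //; exists 0; rewrite ?scaler0.
  - split; first exact: addr_ge0.
    have [ss|ss] := eqVneq (s + s') 0.
      exists 0 => //; have [-> ->] : s = 0 /\ s' = 0 by split; lra.
      by rewrite !scale0r addr0 scaler0.
    have sp : 0 < s + s' by rewrite lt_neqAle eq_sym ss addr_ge0.
    exists ((s / (s + s')) *: w + (1 - s / (s + s')) *: w').
      apply: superlevel_convex => //.
      by rewrite divr_ge0 ?(ltW sp)//= ler_pdivrMr// mul1r lerDl.
    rewrite scalerDr !scalerA; congr (_ *: _ + _ *: _); by field.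
  - split; first exact: normr_ge0.
    have [ui|ui] := leP 0 (u i); first by exists (v i); rewrite ?ger0_norm.
    by exists (- v i); [rewrite fe|rewrite ltr0_norm// scalerN scaleNr opprK].
have s0 : 0 <= \sum_i `|u i| by apply: sumr_ge0.
by apply: le_trans cw _; apply: fun_shrink; rewrite s0.
Qed.

End mult_concave.

Lemma hyperplane_null (R : realType) n (a : 'I_n -> R) (c : R) :
  (exists i, a i != 0) ->
  measurable ([set x : 'rV[R]_n | \sum_i a i * x 0 i = c] : set (borel_rV R n)) /\
  borel_lebesgue R n [set x : 'rV[R]_n | \sum_i a i * x 0 i = c] = 0%E.
Proof.
elim: n a c => [a c [[]]//|n IH a c ai].
pose H := [set x : 'rV[R]_n.+1 | \sum_i a i * x 0 i = c].
have mH : measurable (H : set (borel_rV R n.+1)).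
  have mf : measurable_fun setT
      (fun x : borel_rV R n.+1 => \sum_i a i * (x : 'rV[R]_n.+1) 0 i).
    apply: measurable_sum => i; apply: measurable_funM => //.
    exact: measurable_coord.
  by have := mf measurableT [set c] (measurable_set1 c); rewrite setTI.
split=> //; rewrite -/H.
have := @integral_indic _ _ _ (borel_lebesgue R n.+1) _ measurableT _ mH.
rewrite setIT => <-.
rewrite integral_cons_rV//.
pose Ht (t : R) :=
  [set x : 'rV[R]_n | \sum_i a (lift ord0 i) * x 0 i = c - a ord0 * t].
have HE t x : \1_H (cons_rV (t, x)) = \1_(Ht t) x :> R.
  rewrite !indicE; congr (nat_of_bool _)%:R; apply/idP/idP => /set_mem.
    rewrite /H/= big_ord_recl mxE unlift_none/= => h; apply/mem_set.
    rewrite /Ht/= -h addrC addKr; apply: eq_bigr => i _.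
    by rewrite mxE liftK.
  move=> h; apply/mem_set; rewrite /H/= big_ord_recl mxE unlift_none/=.
  under eq_bigr do rewrite mxE liftK/=.
  by rewrite h addrC subrK.
under eq_integral do under eq_integral do rewrite HE.
have [[i ai0]|a0] := pselect (exists i, a (lift ord0 i) != 0).
  rewrite integral0_eq// => t _.
  have [mHt Ht0] : measurable (Ht t : set (borel_rV R n)) /\
      borel_lebesgue R n (Ht t) = 0%E.
    by apply: (IH (fun i => a (lift ord0 i))); exists i.
  by rewrite integral_indic// setIT.
have a0' i : a (lift ord0 i) = 0.
  by apply/eqP; apply: contrapT => /negP h; apply: a0; exists i.
have a00 : a ord0 != 0.
  by case: ai => i; case: (unliftP ord0 i) => [j ->|-> //]; rewrite a0' eqxx.
pose g (t : R) := (\int[borel_lebesgue R n]_x (\1_(Ht t) x)%:E)%E.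
rewrite -[LHS]/(\int[lebesgue_measure]_t g t)%E.
rewrite (_ : g = g \_ [set c / a ord0]).
  by rewrite -integral_mkcond integral_set1.
apply/funext => t; rewrite patchE; case: ifPn => // /negP tc.
rewrite /g integral0_eq// => x _; rewrite indicE memNset// /Ht/=.
rewrite big1 => [h|i _]; last by rewrite a0' mul0r.
apply: tc; apply/mem_set => /=; apply: (canRL (mulfK a00)); lra.

by apply/measurable_EFinP; exact: measurable_indic.
Qed.

Lemma hyperplane_or_basis (F : fieldType) n (S : set 'rV[F]_n) :
  (exists2 a : 'cV[F]_n, a != 0 & forall x, S x -> x *m a = 0) \/
  (exists2 V : 'M[F]_n, V \in unitmx & forall i, S (row i V)).
Proof.
pose P k := `[< exists2 V : 'M[F]_(k, n), row_free V & forall i, S (row i V) >].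
have P0 : P 0%N.
  by apply/asboolP; exists 0; [rewrite /row_free mxrank0|case].
have Pn k : P k -> (k <= n)%N.
  by move=> /asboolP[V /eqP rV _]; rewrite -[k]rV; exact: rank_leq_col.
case: (ex_maxnP (ex_intro (fun k => P k) 0%N P0) Pn) => k /asboolP[V fV SV] kmax.
have [kn|kn] := eqVneq k n.
  right; move: V fV SV {kmax}; rewrite kn => V fV SV.
  by exists V => //; rewrite -row_free_unit.
left; have SxV x : S x -> (x <= V)%MS.
  move=> Sx; apply/negP => xV.
  have : P k.+1; last by move/kmax; rewrite ltnn.
  apply/asboolP; exists (col_mx x V : 'M[F]_(1 + k, n)); last first.
    move=> i; case: (@split_ordP 1 k i) => j ->.
      by rewrite (_ : row _ _ = x)//; apply/rowP => l; rewrite mxE (@col_mxEu _ 1 k) ord1.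
    rewrite (_ : row _ _ = row j V)//.
    by apply/rowP => l; rewrite mxE (@col_mxEd _ 1 k) mxE.
  rewrite /row_free eqn_leq rank_leq_row/=.
  apply: (@leq_ltn_trans (\rank V)); first by rewrite (eqP fV).
  rewrite -(addsmxE x V).
  apply: rank_ltmx; rewrite ltmxE addsmxSr/= addsmx_sub negb_and.
  exact/orP/or_introl/negP.
have : cokermx V != 0.
  rewrite -mxrank_eq0 mxrank_coker subn_eq0 -ltnNge.
  rewrite ltn_neqAle rank_leq_col andbT.
  by move: fV => /eqP ->.
case/matrix0Pn => i [j Cij]; exists (col j (cokermx V)).
  by apply/matrix0Pn; exists i, 0; rewrite mxE.
move=> x /SxV/submxP[D ->].
by rewrite colE -mulmxA (mulmxA V) mulmx_coker mul0mx mulmx0.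
Qed.

Lemma mult_concave_ge_box (R : realType) n (f : 'rV[R]_n -> R) :
  (forall x, 0 <= f x) -> mult_concave f -> even_fun f ->
  integrable_rV f -> 0 < mass f ->
  exists c d : R, [/\ 0 < c, 0 < d & forall x, box R n d x -> c <= f x].
Proof.
move=> f0 fc fe fi mf.
have [[a a0 fa]|[V Vu fV]] := hyperplane_or_basis [set x | 0 < f x].
  exfalso; move: mf; rewrite /mass /Rintegral.
  pose H := [set x : 'rV[R]_n | \sum_i a i 0 * x 0 i = 0].
  have [mH H0] : measurable (H : set (borel_rV R n)) /\
      borel_lebesgue R n H = 0%E.
    apply: (@hyperplane_null R n (fun i => a i 0)).
    by have /matrix0Pn[i [j]] := a0; rewrite ord1; exists i.
  have -> : (\int[lebesgue_rV R n]_x (f x)%:E =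
      \int[lebesgue_rV R n]_x cst 0 x)%E; last by rewrite integral0/= ltxx.
  apply: ae_eq_integral; [exact: measurableT|by case/integrableP: fi|
    exact: measurable_cst|].
  exists H; split; first exact: measurable_lebesgue_rV.
    by move: (lebesgue_rV_borel mH); rewrite H0.
  move=> x /= /not_implyP[_ fx].
  have xa : x *m a = 0.
    apply: fa; rewrite /= lt_neqAle f0 andbT eq_sym.
    by apply/eqP => fx0; apply: fx; rewrite fx0.
  rewrite /H/=; transitivity ((x *m a) 0 0); last by rewrite xa mxE.
  by rewrite mxE; apply: eq_bigr => i _; rewrite mulrC.
pose c := \big[Order.min/f 0]_i f (row i V).
pose N : R := \sum_i \sum_j `|invmx V j i|.
have N0 : 0 <= N by apply: sumr_ge0 => i _; exact: sumr_ge0.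
have f00 : 0 < f 0.
  have [//|f00] := ltP 0 (f 0).
  exfalso; move: mf; rewrite /mass (_ : f = cst 0) ?Rintegral_cst//= ?mul0r ?ltxx//.
  by apply/funext => x; apply/eqP; rewrite eq_le f0 (le_trans (le_fun0 f0 fc fe x)).
exists c, (N + 1)^-1; split.
- by apply: lt_bigmin => // i _; exact: fV.
- by rewrite invr_gt0 ltr_wpDl.
move=> x xd.
have -> : x = \sum_i (x *m invmx V) 0 i *: row i V.
  by rewrite -mulmx_sum_row mulmxKV.
apply: superlevel_abs_sum => //.
- by apply/ltW/lt_bigmin => // i _; exact: fV.
- by move=> i; exact: bigmin_le.
- exact: bigmin_le_id.
rewrite (@le_trans _ _ (N / (N + 1)))//; last first.
  by rewrite ler_pdivrMr ?mul1r ?lerDl// ltr_wpDl.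
rewrite /N mulr_suml; apply: ler_sum => i _; rewrite mxE.
rewrite mulr_suml (le_trans (ler_norm_sum _ _ _))//.
apply: ler_sum => j _; rewrite normrM mulrC ler_wpM2l//.
by rewrite ler_norml.
Qed.

(* For even log-concave [f] the map [l |-> f (l x)] is nonincreasing on [0, 1],
   so this is its limit at [1]. *)
Definition radial_inf (R : realType) n (f : 'rV[R]_n -> R) (x : 'rV[R]_n) : R :=
  inf [set f (l *: x) | l in [set l : R | 0 < l < 1]].

Section radial_inf.
Context (R : realType) (n : nat) (f : 'rV[R]_n -> R).
Hypotheses (f0 : forall x, 0 <= f x) (fc : mult_concave f) (fe : even_fun f).
Local Notation F := (radial_inf f).

Let half01 : 0 < (2^-1 : R) < 1.
Proof. by apply/andP; split; lra. Qed.

Lemma radial_inf_ge (s : R) x : (forall l, 0 < l < 1 -> s <= f (l *: x)) ->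
  s <= F x.
Proof.
move=> sf; apply: lb_le_inf; first by exists (f (2^-1 *: x)), 2^-1.
by move=> _ [l /= l01 <-]; exact: sf.
Qed.

Lemma radial_inf_le (l : R) x : 0 < l < 1 -> F x <= f (l *: x).
Proof.
move=> l01; apply: ge_inf; last by exists l.
by exists 0 => _ [k _ <-].
Qed.

Lemma radial_inf_ge0 x : 0 <= F x.
Proof. by apply: radial_inf_ge. Qed.

Lemma radial_inf_ge_fun x : f x <= F x.
Proof.
by apply: radial_inf_ge => l /andP[l0 l1]; apply: fun_shrink => //; rewrite !ltW.
Qed.

Lemma radial_inf_even : even_fun F.
Proof.
move=> x; rewrite /radial_inf; congr inf; apply: eq_imagel => l _.
by rewrite scalerN fe.
Qed.

Lemma radial_inf_mult_concave : mult_concave F.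
Proof.
move=> x y t /andP[t0 t1]; apply: radial_inf_ge => l l01.
rewrite scalerDr !scalerA ![l * _]mulrC -!scalerA.
apply: le_trans (fc _ _ _); last by rewrite t0.
by apply: ler_pM; rewrite ?powR_ge0//; apply: ge0_ler_powR;
  rewrite ?subr_ge0 ?nnegrE ?radial_inf_ge0 ?f0 ?radial_inf_le.
Qed.

Context (c d : R).
Hypotheses (c0 : 0 < c) (d0 : 0 < d) (fcd : forall x, box R n d x -> c <= f x).

Lemma radial_inf_open (s : R) : open [set x | F x < s].
Proof.
have [s0|s0] := leP s 0.
  rewrite (_ : mkset _ = set0); first exact: open0.
  by apply/seteqP; split => // x /= /lt_le_trans/(_ s0); rewrite ltNge radial_inf_ge0.
move=> x0 /= Fx0; apply/nbhs_rVP.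
have [l l01 fl] : exists2 l, 0 < l < 1 & f (l *: x0) < s.
  apply: contrapT => h; move: Fx0; rewrite ltNge => /negP; apply.
  apply: radial_inf_ge => l l01; rewrite leNgt; apply/negP => fl.
  by apply: h; exists l.
have /andP[l0 l1] := l01.
have [u /andP[lu u1] fu] : exists2 u, l < u < 1 & f (l *: x0) < s `^ u * c `^ (1 - u).
  have [fl0|fl0] := eqVneq (f (l *: x0)) 0.
    exists ((l + 1) / 2); first by apply/andP; split; lra.
    by rewrite fl0 mulr_gt0// powR_gt0.
  have flp : 0 < f (l *: x0) by rewrite lt_neqAle eq_sym fl0 f0.
  have lnfl : ln (f (l *: x0)) < ln s by rewrite ltr_ln.
  pose D := `|ln s - ln c| + 1.
  have D0 : 0 < D by rewrite ltr_wpDl.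
  pose e := Num.min ((1 - l) / 2) ((ln s - ln (f (l *: x0))) / D).
  have e0 : 0 < e by rewrite lt_min !divr_gt0// subr_gt0.
  have el : e <= (1 - l) / 2 by rewrite ge_min lexx.
  have eD : e * D <= ln s - ln (f (l *: x0)).
    by rewrite -ler_pdivlMr// ge_min lexx orbT.
  exists (1 - e); first by apply/andP; split; lra.
  rewrite /powR !gt_eqF// -expRD -ltr_ln ?posrE ?expR_gt0// expRK.
  have : e * (ln s - ln c) < e * D.
    by rewrite ltr_pM2l// (le_lt_trans (ler_norm _))// ltrDl.
  lra.
have u0 : 0 < u by exact: lt_trans lu.
have u1' : 0 < 1 - u by rewrite subr_gt0.
exists (d * (1 - u) / l); first by rewrite !divr_gt0// mulr_gt0.
move=> x xx0 /=; rewrite ltNge; apply/negP => sF.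
have sf : s <= f ((l / u) *: x).
  by apply: le_trans sF (radial_inf_le _ _); rewrite divr_gt0//= ltr_pdivrMr// mul1r.
pose w := (l / (1 - u)) *: (x0 - x).
have cw : c <= f w.
  apply: fcd => i; rewrite -ler_norml !mxE normrM ger0_norm; last first.
    by rewrite divr_ge0// ltW.
  rewrite mulrAC ler_pdivrMr// mulrC -ler_pdivlMr//; exact/ltW/xx0.
have : s `^ u * c `^ (1 - u) <= f (l *: x0).
  have -> : l *: x0 = u *: ((l / u) *: x) + (1 - u) *: w.
    rewrite /w !scalerA [u * _]mulrC divfK ?gt_eqF//.
    by rewrite [(1 - u) * _]mulrC divfK ?gt_eqF// -scalerDr addrC subrK.
  apply: le_trans (fc _ _ _); last by rewrite !ltW.
  by apply: ler_pM; rewrite ?powR_ge0//; apply: ge0_ler_powR;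
    rewrite ?nnegrE ?f0 ?(ltW u0) ?(ltW u1') ?(ltW s0) ?(ltW c0).
by rewrite leNgt fu.
Qed.

Lemma measurable_radial_inf : measurable_fun setT (F : borel_rV R n -> R).
Proof.
apply: (measurability _ (RGenInftyO.measurableE R)) => //.
move=> _ [_ [s ->] <-]; rewrite setTI.
rewrite (_ : _ @^-1` _ = [set x | F x < s]).
  exact: (open_measurable_rV (@radial_inf_open s)).
by apply/seteqP; split => x /=; rewrite in_itv.
Qed.

Hypothesis (fi : integrable_rV f).
Local Notation mu := (lebesgue_rV R n).
Local Notation lam := (borel_lebesgue R n).

Let mF := measurable_radial_inf.

Let mFC : measurable_fun setT
  (F : caratheodory_type (lam^*)%mu -> R).
Proof. exact: measurable_fun_lebesgue_rV. Qed.

Let mfC : measurable_fun setT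
  (f : caratheodory_type (lam^*)%mu -> R).
Proof. by case/integrableP: fi => /measurable_EFinP. Qed.

Local Open Scope ereal_scope.

Let If_lty : \int[mu]_x (f x)%:E < +oo.
Proof.
case/integrableP: fi => _; apply: le_lt_trans.
rewrite le_eqVlt; apply/orP; left; apply/eqP.
by apply: eq_integral => x _; rewrite gee0_abs ?lee_fin.
Qed.

(* [F (x / l) <= f x], and [F] is Borel, so its integral scales. *)
Let scale_le (l : R) : (0 < l < 1)%R ->
  (l ^+ n)%:E * \int[lam]_x (F x)%:E <= \int[mu]_x (f x)%:E.
Proof.
move=> /andP[l0 l1].
have li0 : (l^-1 != 0)%R by rewrite invr_neq0 ?gt_eqF.
have mFE : measurable_fun setT (fun x : borel_rV R n => (F x)%:E).
  exact/measurable_EFinP.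
have -> : (l ^+ n)%:E * \int[lam]_x (F x)%:E =
    \int[lam]_x (F (l^-1 *: (x : 'rV[R]_n)))%:E.
  rewrite (@ge0_integral_scale R n l^-1 (fun x => (F x)%:E))//.
    by rewrite gtr0_norm ?invr_gt0// invrK.
  by move=> x; rewrite lee_fin radial_inf_ge0.
have ms : measurable_fun setT (fun x : borel_rV R n => (F (l^-1 *: (x : 'rV[R]_n)))%:E).
  have -> : (fun x : borel_rV R n => (F (l^-1 *: (x : 'rV[R]_n)))%:E) =
      (fun x : borel_rV R n => (F x)%:E) \o
      (diag_scale (fun=> (l^-1)%R) : borel_rV R n -> borel_rV R n).
    apply/funext => x /=; congr ((F _)%:E); apply/rowP => i.
    by rewrite !mxE.
  exact: measurableT_comp mFE (@measurable_diag_scale _ _ _).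
rewrite -ge0_integral_lebesgue_rV//; last first.
  by move=> x _; rewrite lee_fin radial_inf_ge0.
apply: ge0_le_integral.
- exact: measurableT.
- by move=> x _; rewrite lee_fin radial_inf_ge0.
- exact: measurable_fun_lebesgue_rV ms.
- exact/measurable_EFinP.
- move=> x _; rewrite lee_fin.
  have := @radial_inf_le l (l^-1 *: (x : 'rV[R]_n))%R.
  by rewrite l0 l1 => /(_ isT); rewrite scalerA mulfV ?gt_eqF// scale1r.
Qed.

Let IF_lty : \int[lam]_x (F x)%:E < +oo.
Proof.
have := scale_le half01; case: (\int[lam]_x (F x)%:E) => //=.
  by move=> *; exact: ltry.
by rewrite gt0_muley ?lte_fin ?exprn_gt0 ?invr_gt0// leNgt If_lty.
Qed.

Lemma integrable_radial_inf : lam.-integrable setT (EFin \o F).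
Proof.
apply/integrableP; split; first exact/measurable_EFinP.
apply: le_lt_trans IF_lty.
rewrite le_eqVlt; apply/orP; left; apply/eqP.
by apply: eq_integral => x _; rewrite gee0_abs ?lee_fin ?radial_inf_ge0.
Qed.

Let IF_le : \int[lam]_x (F x)%:E <= \int[mu]_x (f x)%:E.
Proof.
have F0 : 0 <= \int[lam]_x (F x)%:E.
  by apply: integral_ge0 => x _; rewrite lee_fin radial_inf_ge0.
have f0' : 0 <= \int[mu]_x (f x)%:E by apply: integral_ge0 => x _; rewrite lee_fin.
move: scale_le IF_lty If_lty F0 f0'.
case: (\int[lam]_x (F x)%:E) => [rF| |]//; case: (\int[mu]_x (f x)%:E) => [r| |]//.
move=> H _ _ _ _; rewrite lee_fin leNgt; apply/negP => rrF.
have cv : (l ^+ n * rF)%R @[l --> (1 : R)%R^'-] --> (1 ^+ n * rF)%R.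
  apply: cvgMr_tmp; apply: cvg_at_left_filter; exact: exprn_continuous.
rewrite expr1n mul1r in cv.
have h1 : \forall l \near (1 : R)%R^'-, (r < l ^+ n * rF)%R.
  exact: cvgr_gt cv _ rrF.
have h2 : \forall l \near (1 : R)%R^'-, (0 < l < 1)%R.
  near=> l; apply/andP; split => //; near: l; exact: nbhs_left_gt.
have [l [h3 h4]] := filter_ex (filterI h1 h2).
by have := H _ h4; rewrite -EFinM lee_fin leNgt h3.
Unshelve. all: by end_near.
Qed.

Lemma radial_inf_ae : ae_eq mu setT (EFin \o f) (EFin \o F).
Proof.
have IFE : \int[mu]_x (F x)%:E = \int[lam]_x (F x)%:E.
  apply: ge0_integral_lebesgue_rV => //; first exact/measurable_EFinP.
  by move=> x _; rewrite lee_fin radial_inf_ge0.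
have mFf : measurable_fun setT
    ((fun x => (F x - f x)%:E) : caratheodory_type (lam^*)%mu -> \bar R).
  by apply/measurable_EFinP; exact: measurable_funB.
have D : \int[mu]_x (F x)%:E =
    \int[mu]_x (f x)%:E + \int[mu]_x (F x - f x)%:E.
  rewrite -ge0_integralD; last 5 first.
  - exact: measurableT.
  - by move=> x _; rewrite lee_fin.
  - exact/measurable_EFinP.
  - by move=> x _; rewrite lee_fin subr_ge0 radial_inf_ge_fun.
  - exact: mFf.
  by apply: eq_integral => x _; rewrite -EFinD addrC subrK.
have : \int[mu]_x `|(F x - f x)%:E| = 0.
  have -> : \int[mu]_x `|(F x - f x)%:E| = \int[mu]_x (F x - f x)%:E.
    by apply: eq_integral => x _; rewrite gee0_abs// lee_fin subr_ge0 radial_inf_ge_fun.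
  move: D IF_le If_lty; rewrite IFE => ->.
  have : 0 <= \int[mu]_x (F x - f x)%:E.
    by apply: integral_ge0 => x _; rewrite lee_fin subr_ge0 radial_inf_ge_fun.
  have : 0 <= \int[mu]_x (f x)%:E by apply: integral_ge0 => x _; rewrite lee_fin.
  case: (\int[mu]_x (f x)%:E) => [r| |]//; case: (\int[mu]_x (F x - f x)%:E) => [q| |]//.
  rewrite -EFinD !lee_fin => _ q0 + _; rewrite gerDl => q0'.
  by congr EFin; apply/eqP; rewrite eq_le q0 q0'.
move=> /(ae_eq_integral_abs _ measurableT mFf).
apply: filterS => x /= h /h [] /eqP; rewrite subr_eq0 => /eqP ->.
by [].
Qed.

End radial_inf.

(** * Decay and integrable majorants *)

Section decay.
Context (R : realType) (n : nat) (f : 'rV[R]_n -> R).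
Hypotheses (f0 : forall x, 0 <= f x) (fc : mult_concave f) (fe : even_fun f).
Context (c d : R).
Hypotheses (c0 : 0 < c) (d0 : 0 < d) (fcd : forall x, box R n d x -> c <= f x).
Local Notation lam := (borel_lebesgue R n).
Hypothesis fi : lam.-integrable setT (EFin \o (f : borel_rV R n -> R)).

Let I := \int[lam]_x f x.

(* The superlevel set of [f] at the level [min c (f x)] contains disjoint
   translates of the cube of side [d] along the segment from [0] to [x / 2];
   there are about [`|x 0 i| / (2 d)] of them. *)
Lemma coord_decay_min (x : 'rV[R]_n) i :
  Num.min c (f x) * `|x 0 i| <= 2 * d * (I / d ^+ n).
Proof.
have I0 : 0 <= I by apply: Rintegral_ge0.
have [xi0|xi0] := eqVneq (x 0 i) 0.
  by rewrite xi0 normr0 mulr0 mulr_ge0// ?divr_ge0// ?mulr_ge0// ?exprn_ge0// ltW.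
pose t := `|x 0 i|; have t0 : 0 < t by rewrite normr_gt0.
pose N := Num.truncn (t / (2 * d)).
have td0 : 0 <= t / (2 * d) by rewrite divr_ge0// ?mulr_ge0// ltW.
have NP : N%:R <= t / (2 * d) < N.+1%:R by exact: truncn_itv.
have /andP[N1 N2] := NP.
pose s (k : 'I_N.+1) : R := k%:R * (d / t).
pose J k j := `](s k * x 0 j - d / 2), (s k * x 0 j + d / 2)[%classic.
pose B k : set 'rV[R]_n := [set z | forall j, J k j (z 0 j)].
pose m := Num.min c (f x).
have m0 : 0 <= m by rewrite le_min f0 ltW.
have s01 k : 0 <= s k <= 2^-1.
  apply/andP; split; first by rewrite mulr_ge0// divr_ge0// ltW.
  apply: (@le_trans _ _ (t / (2 * d) * (d / t))).
    apply: ler_wpM2r; first by rewrite divr_ge0// ltW.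
    by apply: le_trans N1; rewrite ler_nat -ltnS.
  rewrite le_eqVlt; apply/orP; left; apply/eqP; field.
  by rewrite !gt_eqF.
have mB k : measurable (B k : set (borel_rV R n)).
  by apply: (@measurable_box R n (J k)) => j; exact: measurable_itv.
have volB k : lam (B k) = (d ^+ n)%:E.
  rewrite (@borel_lebesgue_box R n (J k))//; last by move=> j; exact: measurable_itv.
  rewrite (eq_bigr (fun=> d%:E)) => [|j _].
    by rewrite prodEFin prodr_const card_ord.
  rewrite lebesgue_measure_itv/= lte_fin ltrBlDr -addrA -splitr ltrDl d0.
  by rewrite -EFinB; congr EFin; field.
have Bf k z : B k z -> m <= f z.
  move=> Bz; have /andP[sk0 sk1] := s01 k.
  pose w := (1 - s k)^-1 *: (z - s k *: x).
  have sk : 0 < 1 - s k by lra.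
  have -> : z = s k *: x + (1 - s k) *: w.
    by rewrite /w scalerA mulfV ?gt_eqF// scale1r addrC subrK.
  apply: superlevel_convex => //; last by apply/andP; split; lra.
    by rewrite ge_min lexx orbT.
  rewrite ge_min; apply/orP; left; apply: fcd => j.
  rewrite -ler_norml !mxE normrM ger0_norm ?invr_ge0 ?(ltW sk)//.
  rewrite mulrC ler_pdivrMr//.
  have := Bz j; rewrite /J/= in_itv/= -ltr_distl => /ltW h.
  by apply: (le_trans h); rewrite ler_pM2l//; lra.
have Bdisj k l z : B k z -> B l z -> k = l.
  move=> /(_ i) + /(_ i); rewrite /J/= !in_itv/= -!ltr_distl => h1 h2.
  apply/val_inj/eqP; rewrite eqn_leq; apply/andP.
  have : `|(s k - s l) * x 0 i| < d.
    rewrite mulrBl -(subrKA (z 0 i)) (le_lt_trans (ler_normD _ _))//.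
    by rewrite [d]splitr ltrD// distrC.
  have -> : (s k - s l) * x 0 i = (k%:R - l%:R) * (d / t * x 0 i).
    by rewrite /s; ring.
  rewrite normrM normrM -/t (_ : `|d / t| = d / t); last first.
    by rewrite ger0_norm// divr_ge0// ltW.
  rewrite divfK ?gt_eqF// -[X in _ < X]mul1r ltr_pM2r//.
  rewrite ltr_norml => /andP[h3 h4].
  have h5 : (k%:R : R) < l.+1%:R by rewrite -natr1; lra.
  have h6 : (l%:R : R) < k.+1%:R by rewrite -natr1; lra.
  by move: h5 h6; rewrite !ltr_nat !ltnS.
have sumB z : \sum_k m * \1_(B k) z <= f z.
  have [[k Bk]|nB] := pselect (exists k, B k z).
    rewrite (bigD1 k)//= big1 => [|l lk].
      by rewrite addr0 indicE mem_set// mulr1; exact: Bf Bk.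
    rewrite indicE memNset ?mulr0// => Bl.
    by move: lk; rewrite (Bdisj _ _ _ Bl Bk) eqxx.
  rewrite big1 ?f0// => k _; rewrite indicE memNset ?mulr0// => Bk.
  by apply: nB; exists k.
have : N.+1%:R * m * d ^+ n <= I.
  rewrite -lee_fin /I /Rintegral fineK; last exact: integrable_fin_num.
  apply: (@le_trans _ _ (\int[lam]_z (\sum_k m * \1_(B k) z)%:E)%E); last first.
    apply: ge0_le_integral => //.
    - by move=> z _; rewrite lee_fin sumr_ge0// => k _; rewrite mulr_ge0.
    - apply/measurable_EFinP; apply: measurable_sum => k.
      by apply: measurable_funM => //; exact: (measurable_indic (mB k)).
    - by case/integrableP: fi.
    - by move=> z _; rewrite lee_fin.
  under eq_integral do rewrite -sumEFin.
  rewrite ge0_integral_sum//; last 2 first.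
  - by move=> k; apply/measurable_EFinP; apply: measurable_funM.
  - by move=> k z _; rewrite lee_fin mulr_ge0.
  rewrite (eq_bigr (fun=> (m * d ^+ n)%:E)) => [|k _].
    by rewrite sumEFin sumr_const card_ord -mulrA mulr_natl.
  under eq_integral do rewrite EFinM.
  rewrite ge0_integralZl//; last first.
    by apply/measurable_EFinP; exact: (measurable_indic (mB k)).
  by rewrite integral_indic// setIT -[X in (_ * X)%E]/(lam (B k)) volB EFinM.
have dn0 : 0 < d ^+ n by rewrite exprn_gt0.
rewrite -ler_pdivlMr// => h.
have : t / (2 * d) * m <= I / d ^+ n.
  by apply: le_trans h; rewrite ler_wpM2r// ltW.
rewrite mulrAC ler_pdivrMr ?mulr_gt0// => h'.
by rewrite -/m -/t; move: h'; lra.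
Qed.

Lemma coord_decay : exists2 C : R, 0 <= C & forall x i, f x * `|x 0 i| <= C.
Proof.
have I0 : 0 <= I by apply: Rintegral_ge0.
exists (f 0 / c * (2 * d * (I / d ^+ n))).
  by rewrite !mulr_ge0 ?invr_ge0// ?exprn_ge0// ltW.
move=> x i; apply: le_trans (ler_wpM2l _ (coord_decay_min x i)); last first.
  by rewrite divr_ge0// ltW.
rewrite mulrA ler_wpM2r//.
have cf0 : c <= f 0 by apply: fcd => j; rewrite mxE oppr_le0 ltW.
rewrite mulrAC ler_pdivlMr// minEle; case: ifP => h.
  by rewrite ler_wpM2r ?(ltW c0)// le_fun0.
by rewrite mulrC ler_wpM2r.
Qed.

End decay.

Section domination.
Context (R : realType) (n : nat) (f : 'rV[R]_n -> R).
Hypotheses (f0 : forall x, 0 <= f x) (fc : mult_concave f) (fe : even_fun f).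
Context (c d : R).
Hypotheses (c0 : 0 < c) (d0 : 0 < d) (fcd : forall x, box R n d x -> c <= f x).
Local Notation lam := (borel_lebesgue R n).
Hypothesis fi : lam.-integrable setT (EFin \o (f : borel_rV R n -> R)).
(* The root [p] is integrable and log-concave, so [p x * `|x 0 i|] is bounded;
   hence [p] itself dominates [x_i x_j f = (p x_i) (p x_j) p ^ 2]. *)
Let p (x : 'rV[R]_n) : R := f x `^ 4^-1.

Let mf : measurable_fun setT (f : borel_rV R n -> R).
Proof. by case/integrableP: fi => /measurable_EFinP. Qed.

Let pf x : f x = p x ^+ 4.
Proof. by rewrite /p -powR_mulrn ?powR_ge0// -powRrM mulVf// powRr1. Qed.

Let p0 x : 0 <= p x. Proof. exact: powR_ge0. Qed.

Let pc : mult_concave p.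
Proof.
move=> x y t t01; rewrite /p !(powRAC _ 4^-1) -powRM ?powR_ge0//.
by apply: ge0_ler_powR; rewrite ?nnegrE ?mulr_ge0 ?powR_ge0//; exact: fc.
Qed.

Let pe : even_fun p. Proof. by move=> x; rewrite /p fe. Qed.

Let f00 : 0 < f 0.
Proof. by apply: lt_le_trans c0 (fcd _) => i; rewrite mxE oppr_le0 ltW. Qed.

Let mp : measurable_fun setT (p : borel_rV R n -> R).
Proof. by apply: (measurableT_comp (measurable_powR _)). Qed.

Lemma integrable_fourth_root : lam.-integrable setT (EFin \o (p : borel_rV R n -> R)).
Proof.
pose h (x : borel_rV R n) : \bar R := ((f 0 `^ (3 / 4))^-1 * f x)%:E.
have mh : measurable_fun setT h by apply/measurable_EFinP; exact: measurable_funM.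
have h0 x : (0 <= h x)%E by rewrite lee_fin mulr_ge0// invr_ge0 powR_ge0.
apply/integrableP; split; first exact/measurable_EFinP.
apply: (@le_lt_trans _ _ (\int[lam]_x h (4^-1 *: (x : 'rV[R]_n)))%E).
  apply: ge0_le_integral => //.
  - by apply: measurableT_comp; [exact: abse_measurable|exact/measurable_EFinP].
  - rewrite [X in measurable_fun _ X](_ : _ =
        h \o (diag_scale (fun=> 4^-1) : borel_rV R n -> borel_rV R n)).
      exact: measurableT_comp mh (@measurable_diag_scale _ _ _).
    by apply/funext => x /=; congr h; apply/rowP => i; rewrite !mxE.
  - move=> x _ /=; rewrite lee_fin ger0_norm//.
    rewrite mulrC ler_pdivlMr ?powR_gt0//.
    have := fc x 0 (t := 4^-1); rewrite scaler0 addr0.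
    rewrite (_ : 1 - 4^-1 = 3 / 4 :> R); last by field.
    by apply; apply/andP; split; lra.
rewrite ge0_integral_scale// lte_mul_pinfty// ?lee_fin ?exprn_ge0//.
under eq_integral do rewrite /h EFinM.
rewrite ge0_integralZl//; last 2 first.
- by move=> x _; rewrite lee_fin.
- by rewrite lee_fin invr_ge0 powR_ge0.
rewrite lte_mul_pinfty ?lee_fin ?invr_ge0 ?powR_ge0//.
case/integrableP: fi => _; apply: le_lt_trans.
rewrite le_eqVlt; apply/orP; left; apply/eqP.
by apply: eq_integral => x _; rewrite gee0_abs ?lee_fin.
exact/measurable_EFinP.
Qed.

Let P := p 0.
Let pP x : p x <= P. Proof. exact: le_fun0. Qed.
Let P0 : 0 <= P. Proof. exact: p0. Qed.

Lemma moment_domination : exists K : R, forall (x : 'rV[R]_n) i j,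
  `|x 0 i * x 0 j * f x| <= K * p x.
Proof.
have pcd (x : 'rV[R]_n) : box R n d x -> c `^ 4^-1 <= p x.
  move=> /fcd cx; apply: ge0_ler_powR; rewrite ?nnegrE//; exact: ltW.
have [C C0 pC] := coord_decay p0 pc pe (powR_gt0 _ c0) d0 pcd integrable_fourth_root.
exists (C ^+ 2 * P) => x i j.
rewrite (_ : x 0 i * x 0 j * f x = (p x * x 0 i) * (p x * x 0 j) * p x * p x).
  rewrite normrM (ger0_norm (p0 x)) ler_wpM2r//.
  rewrite normrM (ger0_norm (p0 x)) ler_pM// normrM expr2.
  by rewrite ler_pM// normrM (ger0_norm (p0 x)).
by rewrite pf; ring.
Qed.

Lemma fun_domination : exists K : R, forall x, f x <= K * p x.
Proof.
exists (P ^+ 3) => x; rewrite pf exprSr ler_wpM2r//.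
by rewrite lerXn2r// nnegrE.
Qed.

Lemma entropy_domination : exists K : R, forall x t, 0 <= t <= f x ->
  `|t * ln t| <= K * p x.
Proof.
exists (4 * P ^+ 2 + P ^+ 7) => x t /andP[t0 tf].
have [->|tn0] := eqVneq t 0.
  by rewrite mul0r normr0 mulr_ge0// addr_ge0 ?mulr_ge0 ?exprn_ge0.
have tp : 0 < t by rewrite lt_neqAle eq_sym tn0.
have le3 : 4 * p x ^+ 3 <= 4 * P ^+ 2 * p x.
  rewrite -mulrA ler_pM2l// exprSr ler_wpM2r//.
  by rewrite lerXn2r// nnegrE.
have le8 : p x ^+ 8 <= P ^+ 7 * p x.
  by rewrite exprSr ler_wpM2r// lerXn2r// nnegrE.
rewrite mulrDl normrM (gtr0_norm tp).
have [t1|t1] := leP t 1.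
  rewrite ler0_norm ?ln_le0//.
  pose q := t `^ 4^-1; have q0 : 0 < q by exact: powR_gt0.
  have tq : t = q ^+ 4.
    by rewrite /q -powR_mulrn ?powR_ge0// -powRrM mulVf// powRr1.
  have qp : q <= p x by apply: ge0_ler_powR; rewrite ?nnegrE.
  have lnt : - ln t <= 4 * (q^-1 - 1).
    have -> : ln t = 4 * ln q by rewrite {1}tq lnXn// mulr_natl.
    rewrite -mulrN ler_pM2l// -lnV ?posrE//.
    by rewrite -[X in ln X](subrK 1) addrC le_ln1Dx// ltrBrDl subrr invr_gt0.
  apply: (@le_trans _ _ (4 * q ^+ 3)).
    apply: (le_trans (ler_wpM2l (ltW tp) lnt)).
    rewrite {1}tq (_ : q ^+ 4 * (4 * (q^-1 - 1)) = 4 * q ^+ 3 - 4 * q ^+ 4).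
      by rewrite gerDl oppr_le0 mulr_ge0// exprn_ge0// ltW.
    by field; rewrite gt_eqF.
  apply: (@le_trans _ _ (4 * p x ^+ 3)).
    by rewrite ler_pM2l// lerXn2r// nnegrE// ltW.
  by rewrite (le_trans le3)// lerDl mulr_ge0// exprn_ge0.
rewrite ger0_norm ?ln_ge0//; last exact: ltW.
have tln : t * ln t <= t * t.
  by rewrite ler_pM2l//; exact/ltW/ln_sublinear.
apply: (le_trans tln); apply: (@le_trans _ _ (p x ^+ 8)).
  have -> : p x ^+ 8 = f x * f x by rewrite pf; ring.
  by rewrite ler_pM.
by rewrite (le_trans le8)// lerDr mulr_ge0// mulr_ge0// exprn_ge0.
Qed.

End domination.

(** * The convex bodies over a log-concave function *)

(* The exponential form of [`|y_j| <= 1 + ln (f x) / m] excludes the points with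
   [f x = 0], where [ln 0 = 0] would let every such [x] in. *)
Definition power_body (R : realType) n m (f : 'rV[R]_n -> R) : set 'rV[R]_(n + m) :=
  [set z : 'rV[R]_(n + m) | forall j : 'I_m,
    expR (m%:R * (`|z 0 (rshift n j)| - 1)) <= f (lsubmx z)].
Arguments power_body {R n} m f.

Section power_body.
Context (R : realType) (n : nat) (f : 'rV[R]_n -> R).
Hypotheses (f0 : forall x, 0 <= f x) (fc : mult_concave f) (fe : even_fun f).
Context (m : nat).
Hypothesis m0 : (0 < m)%N.
Local Notation K := (power_body m f).

Lemma power_body_sym : centrally_symmetric K.
Proof.
have sK z : K z -> K (- z).
  by move=> Kz j; rewrite mxE normrN linearN fe.
apply/seteqP; split => [z /sK Kz|_ [z /sK Kz <-]//].
by exists (- z) => //; rewrite opprK.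
Qed.

Lemma power_body_convex : convex_set K.
Proof.
apply/convex_setP => x y t /andP[t0 t1] Kx Ky j.
rewrite linearD !linearZ/=.
apply: le_trans (fc _ _ _); last by rewrite t0.
have t1' : 0 <= 1 - t by rewrite subr_ge0.
apply: (@le_trans _ _ (expR (m%:R * (`|x 0 (rshift n j)| - 1)) `^ t *
    expR (m%:R * (`|y 0 (rshift n j)| - 1)) `^ (1 - t))).
  rewrite -!expRM -expRD ler_expR !mxE.
  rewrite -!(mulrA m%:R) -mulrDr ler_wpM2l//.
  have : `|t * x 0 (rshift n j) + (1 - t) * y 0 (rshift n j)| <=
      t * `|x 0 (rshift n j)| + (1 - t) * `|y 0 (rshift n j)|.
    rewrite (le_trans (ler_normD _ _))// !normrM.
    by rewrite (ger0_norm t0) (ger0_norm t1').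
  lra.
by apply: ler_pM; rewrite ?powR_ge0//; apply: ge0_ler_powR;
  rewrite ?nnegrE ?expR_ge0 ?f0.
Qed.

Lemma power_body_closed : (forall s, open [set x | f x < s]) -> closed K.
Proof.
move=> fo; rewrite -openC openE => z /existsNP[j /negP]; rewrite -ltNge => fz.
pose s := (f (lsubmx z) + expR (m%:R * (`|z 0 (rshift n j)| - 1))) / 2.
have fs : f (lsubmx z) < s by rewrite /s; lra.
have sz : s < expR (m%:R * (`|z 0 (rshift n j)| - 1)) by rewrite /s; lra.
have : nbhs z [set w : 'rV[R]_(n + m) | f (lsubmx w) < s].
  have /nbhs_rVP[e e0 eP] := fo s _ fs.
  apply/nbhs_rVP; exists e => // w zw; apply: eP => i.
  by have := zw (lshift m i); rewrite !mxE.
have : nbhs z [set w : 'rV[R]_(n + m) |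
    s < expR (m%:R * (`|w 0 (rshift n j)| - 1))].
  have cv : expR (m%:R * (`|w 0 (rshift n j)| - 1)) @[w --> (z : 'rV[R]_(n + m))]
      --> expR (m%:R * (`|z 0 (rshift n j)| - 1)).
    apply: continuous_cvg; first exact: continuous_expR.
    apply: cvgMl_tmp; apply: cvgB; last exact: cvg_cst.
    apply: cvg_norm; exact: coord_continuous.
  exact: cvgr_gt cv _ sz.
apply: filterS2 => w h1 h2 Kw; have := Kw j.
by rewrite leNgt (lt_trans h2 h1).
Qed.

Context (c d : R).
Hypotheses (c0 : 0 < c) (d0 : 0 < d) (fcd : forall x, box R n d x -> c <= f x).

Lemma power_body_interior : expR (- (m%:R / 2)) <= c -> K° !=set0.
Proof.
move=> mc; exists 0; apply/nbhs_rVP.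
exists (Num.min d 2^-1); first by rewrite lt_min d0 invr_gt0 ltr0n.
move=> z z0 j; apply: (@le_trans _ _ c).
  apply: le_trans mc; rewrite ler_expR.
  have := z0 (rshift n j); rewrite mxE sub0r normrN lt_min => /andP[_ h].
  have : m%:R * (`|z 0 (rshift n j)| - 1) <= m%:R * (- 2^-1) :> R.
    by rewrite ler_wpM2l//; lra.
  lra.
apply: fcd => i; rewrite mxE -ler_norml.
by have := z0 (lshift m i); rewrite mxE sub0r normrN lt_min => /andP[/ltW].
Qed.

Lemma power_body_bounded (C : R) :
  (forall x i, f x * `|x 0 i| <= C) -> bounded_set K.
Proof.
move=> fC; pose B1 := C / expR (- m%:R); pose B2 := 1 + ln (f 0) / m%:R.
have C0 : 0 <= `|C| by [].
exists (`|B1| + `|B2|); split; first exact: num_real.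
move=> M ltM z Kz; rewrite /= [leLHS]/Num.norm/= mx_normrE.
have M0 : 0 <= M by rewrite (le_trans _ (ltW ltM))// addr_ge0.
apply/bigmax_leP; split => // -[i k] _ /=; rewrite ord1 {i}.
apply: le_trans (ltW ltM).
have mp : 0 < m%:R :> R by rewrite ltr0n.
case: (split_ordP k) => j ->.
  apply: (@le_trans _ _ `|B1|); last by rewrite lerDl.
  apply: le_trans (ler_norm _); rewrite ler_pdivlMr ?expR_gt0// mulrC.
  apply: le_trans (fC (lsubmx z) j); rewrite mxE ler_wpM2r//.
  apply: le_trans (Kz (Ordinal m0)); rewrite ler_expR.
  have : m%:R * (0 - 1) <= m%:R * (`|z 0 (rshift n (Ordinal m0))| - 1) :> R.
    by rewrite ler_wpM2l// lerD2r.
  lra.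
apply: (@le_trans _ _ `|B2|); last by rewrite lerDr.
apply: le_trans (ler_norm _); rewrite /B2 -lerBlDl ler_pdivlMr// mulrC.
rewrite -ler_expR lnK; last first.
  rewrite posrE; apply: lt_le_trans c0 (fcd _) => i.
  by rewrite mxE oppr_le0 ltW.
by apply: le_trans (Kz j) _; exact: le_fun0.
Qed.

End power_body.

Definition tent (R : realType) (m : nat) (t : R) : R :=
  if 0 < t then Num.max 0 (1 + ln t / m%:R) else 0.

Section tent.
Context (R : realType) (m : nat).
Local Notation g := (@tent R m).

Lemma tent_ge0 t : 0 <= g t.
Proof. by rewrite /tent; case: ifP => // _; rewrite le_max lexx. Qed.

Lemma measurable_tent : measurable_fun setT g.
Proof.
apply: measurable_fun_ifT.
- apply: measurable_fun_ltr => //.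
- apply: measurable_maxr => //; apply: measurable_funD => //.
  by apply: measurable_funM => //; exact: measurable_ln.
- exact: measurable_cst.
Qed.

End tent.

Section power_body_integrals.
Context (R : realType) (n m : nat) (f : 'rV[R]_n -> R).
Hypotheses (m0 : (0 < m)%N) (mf : measurable_fun setT (f : borel_rV R n -> R)).
Local Notation K := (power_body m f).
Hypothesis (mK : measurable (K : set (borel_rV R (n + m)))).
Local Notation lam := (borel_lebesgue R).
Let g (x : 'rV[R]_n) : R := tent m (f x).
(* A negative half-width encodes the empty fibre over a zero of [f]. *)
Let G (x : 'rV[R]_n) : R := if 0 < f x then 1 + ln (f x) / m%:R else -1.

Let mg : measurable_fun setT (g : borel_rV R n -> R).
Proof. by apply: measurableT_comp mf; exact: measurable_tent. Qed.

Let power_body_row_mx x y : K (row_mx x y) <-> box R m (G x) y.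
Proof.
have mp : 0 < m%:R :> R by rewrite ltr0n.
rewrite /power_body/= row_mxKl /G; case: ltP => fx; last first.
  split => [/(_ (Ordinal m0))|/(_ (Ordinal m0)) /andP[]].
    by rewrite leNgt (le_lt_trans fx)// expR_gt0.
  by move=> h1 /(le_trans h1); rewrite opprK; lra.
split => h j; have := h j; rewrite row_mxEr.
  rewrite -{1}(lnK fx) ler_expR mulrC -ler_pdivlMr// lerBlDl => h'.
  by rewrite -ler_norml.
rewrite -ler_norml -lerBlDl ler_pdivlMr// => h'.
by rewrite -[leRHS](lnK fx) ler_expR mulrC.
Qed.

Let indic_power_body x y : \1_K (row_mx x y) = \1_(box R m (G x)) y :> R.
Proof.
rewrite !indicE; congr (nat_of_bool _)%:R.
by apply/idP/idP => /set_mem/power_body_row_mx/mem_set.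
Qed.

Let box_g x : (0 <= G x /\ g x = G x) \/ (G x < 0 /\ g x = 0).
Proof.
rewrite /G /g /tent; case: ifP => _; last by right; rewrite oppr_lt0.
by have [h|h] := leP 0 (1 + ln (f x) / m%:R); [left|right].
Qed.

Let vol_box x : lam m (box R m (G x)) = ((2 * g x) ^+ m)%:E.
Proof.
have [[G0 ->]|[G0 ->]] := box_g x; first exact: vol_symbox.
by rewrite symbox_lt0// measure0 mulr0 expr0n gtn_eqF.
Qed.

Let sqr_box x j :
  (\int[lam m]_(y in box R m (G x)) ((y : 'rV[R]_m) 0 j ^+ 2)%:E)%E =
  ((2 * g x) ^+ m * (g x ^+ 2 / 3))%:E.
Proof.
have [[G0 ->]|[G0 ->]] := box_g x; first exact: integral_symbox_sqr.
by rewrite symbox_lt0// integral_set0 mulr0 expr0n gtn_eqF// mul0r.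
Qed.

Lemma measurable_lsubmx : measurable_fun setT
  (fun z : borel_rV R (n + m) => lsubmx (z : 'rV[R]_(n + m)) : borel_rV R n).
Proof.
apply: measurable_fun_rV => i.
rewrite [X in measurable_fun _ X](_ : _ =
    (fun z : borel_rV R (n + m) => (z : 'rV[R]_(n + m)) ord0 (lshift m i))).
  exact: measurable_coord.
by apply/funext => z; rewrite mxE.
Qed.

Let m1K : measurable_fun setT (\1_K : borel_rV R (n + m) -> R).
Proof. exact: measurable_indic. Qed.

Let measurable_indic_box r :
  measurable_fun setT (\1_(box R m r) : borel_rV R m -> R).
Proof. apply: measurable_indic; exact: measurable_symbox. Qed.

Lemma ge0_integral_power_body (h : borel_rV R n -> R) :
  measurable_fun setT h -> (forall x, 0 <= h x) ->
  (\int[lam (n + m)%N]_z (h (lsubmx (z : 'rV[R]_(n + m))) * \1_K z)%:E =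
   \int[lam n]_x (h x * (2 * g x) ^+ m)%:E)%E.
Proof.
move=> mh h0; rewrite integral_row_mx; last 2 first.
- apply/measurable_EFinP; apply: measurable_funM => //.
  exact: measurableT_comp mh measurable_lsubmx.
- by move=> z; rewrite lee_fin mulr_ge0.
apply: eq_integral => x _.
under eq_integral do rewrite row_mxKl indic_power_body EFinM.
rewrite ge0_integralZl//; last 2 first.
- by apply/measurable_EFinP; exact: measurable_indic_box.
- by rewrite lee_fin.
rewrite integral_indic//; last exact: measurable_symbox.
by rewrite setIT EFinM; congr (_ * _)%E; exact: vol_box.
Qed.

Lemma Rintegral_power_body (h : borel_rV R n -> R) : measurable_fun setT h ->
  \int[lam (n + m)%N]_(z in K) h (lsubmx (z : 'rV[R]_(n + m))) =
  \int[lam n]_x (h x * (2 * g x) ^+ m).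
Proof.
move=> mh; rewrite Rintegral_mkcond /Rintegral; congr fine.
rewrite integralE [RHS]integralE.
have w0 x : 0 <= (2 * g x) ^+ m by rewrite exprn_ge0// mulr_ge0// tent_ge0.
have mpos : measurable_fun setT (fun x => Num.max (h x) 0).
  exact: measurable_maxr.
have mneg : measurable_fun setT (fun x => Num.max (- h x) 0).
  by apply: measurable_maxr => //; exact: measurableT_comp.
congr (_ - _)%E.
- transitivity (\int[lam n]_x (Num.max (h x) 0 * (2 * g x) ^+ m)%:E)%E.
    rewrite -ge0_integral_power_body// => [|x]; last by rewrite le_max lexx orbT.
    apply: eq_integral => z _; rewrite funeposE/= patch_indic/= -EFin_max.
    by rewrite maxr_pMl ?mul0r.
  by apply: eq_integral => x _; rewrite funeposE/= -EFin_max maxr_pMl ?mul0r.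
- transitivity (\int[lam n]_x (Num.max (- h x) 0 * (2 * g x) ^+ m)%:E)%E.
    rewrite -ge0_integral_power_body// => [|x]; last by rewrite le_max lexx orbT.
    apply: eq_integral => z _; rewrite funenegE/= patch_indic/= -EFin_max.
    by rewrite maxr_pMl ?mul0r ?mulNr.
  by apply: eq_integral => x _; rewrite funenegE/= -EFin_max maxr_pMl ?mul0r ?mulNr.
Qed.

Lemma vol_power_body :
  vol K = \int[lam n]_x ((2 * g x) ^+ m).
Proof.
rewrite /vol lebesgue_rV_borel// /Rintegral; congr fine.
have := @integral_indic _ _ _ (lam (n + m)%N) setT measurableT K mK.
rewrite setIT => <-.
transitivity (\int[lam n]_x (1 * (2 * g x) ^+ m)%:E)%E; last first.
  by apply: eq_integral => x _; rewrite mul1r.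
rewrite -(@ge0_integral_power_body (cst 1))//.
by apply: eq_integral => z _; rewrite /= mul1r.
Qed.

Lemma Rintegral_power_body_sqr j :
  \int[lam (n + m)%N]_(z in K)
    ((z : 'rV[R]_(n + m)) 0 (rshift n j) * (z : 'rV[R]_(n + m)) 0 (rshift n j)) =
  \int[lam n]_x ((2 * g x) ^+ m * (g x ^+ 2 / 3)).
Proof.
rewrite Rintegral_mkcond /Rintegral; congr fine.
have mz : measurable_fun setT
    (fun z : borel_rV R (n + m) => (z : 'rV[R]_(n + m)) 0 (rshift n j)).
  exact: measurable_coord.
rewrite (eq_integral (fun z : borel_rV R (n + m) =>
  ((z : 'rV[R]_(n + m)) 0 (rshift n j) ^+ 2 * \1_K z)%:E)); last first.
  by move=> z _; rewrite patch_indic expr2.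
rewrite integral_row_mx; last 2 first.
- by apply/measurable_EFinP; apply: measurable_funM => //; exact: measurable_funX.
- by move=> z; rewrite lee_fin mulr_ge0// sqr_ge0.
apply: eq_integral => x _; rewrite -(sqr_box x j) [RHS]integral_mkcond.
apply: eq_integral => y _.
by rewrite row_mxEr indic_power_body restrict_EFin/= patch_indic.
Qed.

Lemma Rintegral_power_body_cross a j : a != rshift n j ->
  \int[lam (n + m)%N]_(z in K)
    ((z : 'rV[R]_(n + m)) 0 a * (z : 'rV[R]_(n + m)) 0 (rshift n j)) = 0.
Proof.
move=> aj.
pose s b : R := if b == rshift n j then -1 else 1.
apply: (@Rintegral_odd _ _ s) => //.
- by move=> b; rewrite /s; case: ifP; rewrite ?normrN1 ?normr1.
- by apply: measurable_funM; exact: measurable_coord.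
- move=> z.
  have sl : lsubmx (diag_scale s z) = lsubmx z.
    apply/rowP => i; rewrite !mxE /s ifF ?mul1r//.
    apply/negbTE/eqP => /(congr1 val)/= ij.
    by have := ltn_ord i; rewrite ij ltnNge leq_addr.
  have sr k : `|diag_scale s z 0 (rshift n k)| = `|z 0 (rshift n k)|.
    by rewrite mxE /s; case: ifP; rewrite ?mulN1r ?normrN ?mul1r.
  by split => Kz k; have := Kz k; rewrite sl sr.
- by move=> z; rewrite !mxE /s eqxx (negbTE aj); ring.
Qed.

End power_body_integrals.

Lemma powR_invn_exprn (R : realType) (N : nat) (x : R) : (0 < N)%N -> 0 <= x ->
  (x `^ N%:R^-1) ^+ N = x.
Proof.
by move=> N0 x0; rewrite -powR_mulrn ?powR_ge0// -powRrM mulVf ?powRr1// pnatr_eq0 -lt0n.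
Qed.

Lemma powR_inv2n_exprn (R : realType) (N : nat) (x : R) : (0 < N)%N -> 0 <= x ->
  (x `^ (2 * N%:R)^-1) ^+ (2 * N) = x.
Proof. by move=> N0 x0; rewrite -natrM powR_invn_exprn// muln_gt0. Qed.

Lemma sqrt12_exprn (R : realType) (N : nat) :
  (1 / Num.sqrt 12) ^+ (2 * N) = (12 ^+ N)^-1 :> R.
Proof. by rewrite exprM expr_div_n expr1n sqr_sqrtr// expr_div_n expr1n div1r. Qed.

Lemma det_le_of_isotropic (R : realType) (N : nat) (D V : R) :
  (0 < N)%N -> 0 < V ->
  D `^ (2 * N%:R)^-1 / V `^ N%:R^-1 <= 1 / Num.sqrt 12 ->
  D <= V ^+ 2 / 12 ^+ N.
Proof.
move=> N0 V0 h; have [D0|D0] := leP D 0.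
  by rewrite (le_trans D0)// divr_ge0// exprn_ge0// ltW.
have : (D `^ (2 * N%:R)^-1 / V `^ N%:R^-1) ^+ (2 * N) <= (1 / Num.sqrt 12) ^+ (2 * N).
  by rewrite lerXn2r// nnegrE ?divr_ge0 ?powR_ge0 ?sqrtr_ge0.
rewrite sqrt12_exprn expr_div_n powR_inv2n_exprn ?(ltW D0)//.
rewrite [X in _ / X](_ : _ = V ^+ 2).
  by rewrite ler_pdivrMr ?exprn_gt0// mulrC.
by rewrite mulnC exprM powR_invn_exprn// ltW.
Qed.

Lemma isotropic_le_of_det (R : realType) (N : nat) (D E V : R) :
  (0 < N)%N -> 0 < V -> 0 <= D -> D * expR (2 * E) <= V ^+ 2 / 12 ^+ N ->
  (expR E / V) `^ N%:R^-1 * D `^ (2 * N%:R)^-1 <= 1 / Num.sqrt 12.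
Proof.
move=> N0 V0 D0 h.
have EV0 : 0 <= expR E / V by rewrite divr_ge0 ?expR_ge0 ?ltW.
have N2 : (0 < 2 * N)%N by rewrite muln_gt0.
have E1 : (D `^ (2 * N%:R)^-1) ^+ (2 * N) = D by exact: powR_inv2n_exprn.
have E2 : ((expR E / V) `^ N%:R^-1) ^+ (2 * N) = (expR E / V) ^+ 2.
  by rewrite mulnC exprM powR_invn_exprn.
have n1 : (expR E / V) `^ N%:R^-1 * D `^ (2 * N%:R)^-1 \in Num.nneg.
  by rewrite nnegrE mulr_ge0 ?powR_ge0.
have n2 : 1 / Num.sqrt 12 \in @Num.nneg R.
  by rewrite nnegrE divr_ge0 ?sqrtr_ge0.
rewrite -(ler_pXn2r N2 n1 n2) exprMn E1 E2 sqrt12_exprn expr_div_n.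
rewrite mulrAC ler_pdivrMr ?exprn_gt0// [leRHS]mulrC [leLHS]mulrC.
by move: h; rewrite (_ : 2 * E = E + E) ?expRD -?expr2//; ring.
Qed.

Section body_inequality.
Context (R : realType) (n m : nat) (f : 'rV[R]_n -> R).
Hypotheses (f0 : forall x, 0 <= f x) (fe : even_fun f) (m0 : (0 < m)%N).
Hypotheses (mf : measurable_fun setT (f : borel_rV R n -> R)).
Local Notation K := (power_body m f).
Hypothesis (mK : measurable (K : set (borel_rV R (n + m)))).
Local Notation lam := (borel_lebesgue R n).
Let g (x : 'rV[R]_n) : R := tent m (f x).
Let S := \int[lam]_x (g x ^+ m).
Let T := \int[lam]_x (g x ^+ m * g x ^+ 2).
Let A : 'M[R]_n := \matrix_(i, j)
  (\int[lam]_x ((x : 'rV[R]_n) 0 i * (x : 'rV[R]_n) 0 j * g x ^+ m) / S).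
Hypotheses (iS : lam.-integrable setT (fun x => (g x ^+ m)%:E))
  (iT : lam.-integrable setT (fun x => (g x ^+ m * g x ^+ 2)%:E))
  (iA : forall i j, lam.-integrable setT
    (fun x : borel_rV R n =>
      ((x : 'rV[R]_n) 0 i * (x : 'rV[R]_n) 0 j * g x ^+ m)%:E)).

Lemma vol_power_bodyE : vol K = 2 ^+ m * S.
Proof.
rewrite vol_power_body// /S -RintegralZl//.
by apply: eq_Rintegral => x _; rewrite exprMn.
Qed.

Lemma covariance_power_body : vol K != 0 ->
  covariance_mx K = block_mx A 0 0 (T / S / 3)%:M.
Proof.
move=> V0; have S0 : S != 0.
  by apply: contraNneq V0 => S0; rewrite vol_power_bodyE S0 mulr0.
have two0 : 2 ^+ m != 0 :> R by rewrite expf_neq0.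
have sK : centrally_symmetric K by exact: power_body_sym.
rewrite /covariance_mx barycenter_sym0// mulmx0 subr0.
have mz a b : measurable_fun (K : set (borel_rV R (n + m)))
    (fun z : borel_rV R (n + m) => (z : 'rV[R]_(n + m)) 0 a * (z : 'rV[R]_(n + m)) 0 b).
  by apply: measurable_funTS; apply: measurable_funM; exact: measurable_coord.
have VE := vol_power_bodyE.
have cross a j : a != rshift n j -> (vol K)^-1 *
    \int[lebesgue_rV R (n + m)]_(z in K) (z 0 a * z 0 (rshift n j)) = 0.
  by move=> aj; rewrite Rintegral_lebesgue_rV// Rintegral_power_body_cross// mulr0.
apply/matrixP => a b; rewrite mxE.
case: (split_ordP a) => i ->; case: (split_ordP b) => j ->.
- rewrite block_mxEul mxE Rintegral_lebesgue_rV//.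
  pose h (x : borel_rV R n) := (x : 'rV[R]_n) 0 i * (x : 'rV[R]_n) 0 j.
  have mh : measurable_fun setT h.
    by apply: measurable_funM; exact: measurable_coord.
  rewrite (@eq_Rintegral _ _ _ _ _ (fun z : borel_rV R (n + m) =>
    h (lsubmx (z : 'rV[R]_(n + m))))); last by move=> z _; rewrite /h !mxE.
  rewrite (Rintegral_power_body m0 mK mh).
  rewrite (@eq_Rintegral _ _ _ _ _ (fun x : borel_rV R n => 2 ^+ m *
    ((x : 'rV[R]_n) 0 i * (x : 'rV[R]_n) 0 j * g x ^+ m))); last first.
    by move=> x _; rewrite exprMn mulrCA.
  rewrite RintegralZl//; last exact: iA.
  by rewrite VE; field; rewrite two0 S0.
- rewrite block_mxEur mxE cross//; apply/eqP => /(congr1 val)/= h.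
  by have := ltn_ord i; rewrite h ltnNge leq_addr.
- rewrite block_mxEdl mxE; under eq_Rintegral do rewrite mulrC.
  rewrite cross//; apply/eqP => /(congr1 val)/= h.
  by have := ltn_ord j; rewrite h ltnNge leq_addr.
- rewrite block_mxEdr mxE; have [<-|ij] := eqVneq i j; last first.
    by rewrite cross// (inj_eq (@rshift_inj _ _)).
  rewrite mulr1n Rintegral_lebesgue_rV// Rintegral_power_body_sqr//.
  rewrite (@eq_Rintegral _ _ _ _ _ (fun x : borel_rV R n =>
    2 ^+ m / 3 * (g x ^+ m * g x ^+ 2))); last first.
    by move=> x _; rewrite exprMn -/(g x); field.
  rewrite RintegralZl//.
  by rewrite -/T VE; field; rewrite two0 S0.
Qed.

Lemma power_body_inequality : 0 < vol K ->
  isotropic_constant K <= 1 / Num.sqrt 12 ->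
  \det A * (T / S) ^+ m <= S ^+ 2 / 12 ^+ n.
Proof.
move=> V0; rewrite /isotropic_constant covariance_power_body ?gt_eqF//.
move=> /det_le_of_isotropic; rewrite addn_gt0 m0 orbT => /(_ isT V0).
rewrite det_ublock det_scalar vol_power_bodyE.
move=> h; have p12 : 0 < (12 ^+ m : R) by rewrite exprn_gt0.
have -> : \det A * (T / S) ^+ m = 3 ^+ m * (\det A * (T / S / 3) ^+ m).
  by rewrite [(T / S / 3) ^+ m]expr_div_n; field; rewrite expf_neq0.
have -> : S ^+ 2 / 12 ^+ n = 3 ^+ m * ((2 ^+ m * S) ^+ 2 / 12 ^+ (n + m)).
  have E12 : 12 ^+ m = 3 ^+ m * (2 ^+ m) ^+ 2 :> R.
    by rewrite -exprM mulnC exprM -exprMn; congr (_ ^+ m); ring.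
  by rewrite exprD E12; field; rewrite !expf_neq0.
by rewrite ler_pM2l// exprn_gt0.
Qed.

End body_inequality.

(** * Passage to the limit *)

(* The characteristic polynomial of [- A] is monic without positive roots, so it
   is nonnegative at [0].  The sign matters because [a `^ x = 1] for [a < 0]: a
   mere upper bound on [\det A] would not bound its power. *)
Lemma psd_det_ge0 (R : rcfType) n (A : 'M[R]_n) :
  (forall v : 'rV[R]_n, 0 <= (v *m A *m v^T) 0 0) -> 0 <= \det A.
Proof.
move=> psd; rewrite leNgt; apply/negP => dA.
pose p := char_poly (- A).
have p0 : p.[0] = \det A.
  have NA : \det (- A) = (-1) ^+ n * \det A by rewrite -[in LHS]scaleN1r detZ.
  rewrite horner_coef0 char_poly_det NA mulrA -exprMn.
  by rewrite mulN1r opprK expr1n mul1r.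
have lp : 0 < lead_coef p by rewrite (monicP (char_poly_monic _)).
have [M pM] := polyrcf.poly_pinfty_gt_lc lp.
pose b := Num.max M 1.
have b0 : 0 <= b by rewrite le_max ler01 orbT.
have pb : 0 < p.[b] by apply: lt_le_trans lp (pM _ _); rewrite le_max lexx.
have [t tb /rootP/eqP pt] : {t | t \in `]0, b[ & root p t}.
  by apply: polyrcf.poly_ivtoo; rewrite // p0 nmulr_rlt0.
have t0 : 0 < t by move: tb; rewrite in_itv/= => /andP[].
have /eigenvalueP[v vA v0] : eigenvalue (- A) t.
  by rewrite eigenvalue_root_char.
have vA' : v *m A = - t *: v by rewrite scaleNr -vA mulmxN opprK.
have := psd v; rewrite vA' -scalemxAl mxE mulNr oppr_ge0 pmulr_rle0//.
rewrite mxE leNgt => /negP; apply.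
have [i vi] : exists i, v 0 i != 0.
  by move/matrix0Pn: v0 => [j [i]]; rewrite ord1; exists i.
rewrite (bigD1 i)//= ltr_pwDl//.
  by rewrite mxE -expr2 exprn_even_gt0.
by apply: sumr_ge0 => j _; rewrite mxE -expr2 sqr_ge0.
Qed.

Lemma cvg_det (R : realType) n (A_ : nat -> 'M[R]_n) (A : 'M[R]_n) :
  (forall i j, A_ k i j @[k --> \oo] --> A i j) ->
  \det (A_ k) @[k --> \oo] --> \det A.
Proof.
move=> cA; rewrite /determinant.
apply: cvg_big => [|s _]; first exact: add_continuous.
apply: cvgMl_tmp; apply: cvg_big => [|i _]; first exact: mul_continuous.
exact: cA.
Qed.

Lemma expR_ratio_le (R : realType) (u : R) : -1 < u -> expR (u / (1 + u)) <= 1 + u.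
Proof.
move=> u1; have u0 : 0 < 1 + u by lra.
rewrite -[leRHS]invrK -[leLHS]invrK -expRN lef_pV2 ?posrE ?expR_gt0 ?invr_gt0//.
apply: le_trans (expR_ge1Dx _); rewrite le_eqVlt; apply/orP; left; apply/eqP.
by field; rewrite gt_eqF.
Qed.

Section tent_limit.
Context (R : realType).

Lemma tent_exprn_le m (t : R) : (0 < m)%N -> 0 <= t -> tent m t ^+ m <= t.
Proof.
move=> m0 t0; rewrite /tent; case: ifPn => [tp|_]; last by rewrite expr0n gtn_eqF.
have [h|h] := leP 0 (1 + ln t / m%:R); last by rewrite expr0n gtn_eqF// ltW.
apply: (@le_trans _ _ (expR (ln t / m%:R) ^+ m)).
  by rewrite lerXn2r ?nnegrE ?expR_ge0// expR_ge1Dx.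
by rewrite -expRM_natl mulrC divfK ?lnK// pnatr_eq0 -lt0n.
Qed.

Lemma tent_le m (t : R) : (0 < m)%N -> 0 <= t -> tent m t <= 1 + t.
Proof.
move=> m0 t0; rewrite /tent; case: ifPn => tp; last by rewrite addr_ge0.
rewrite ge_max addr_ge0//= lerD2l ler_pdivrMr ?ltr0n//.
have [l0|l0] := leP (ln t) 0; first by rewrite (le_trans l0)// mulr_ge0.
apply: (le_trans (ltW (ln_sublinear tp))); rewrite ler_peMr//.
by rewrite ler1n.
Qed.

Lemma cvg_tent (t : R) : 0 <= t -> tent k.+1 t ^+ k.+1 @[k --> \oo] --> t.
Proof.
rewrite le_eqVlt => /orP[/eqP <-|t0].
  rewrite /tent ltxx; under eq_fun do rewrite expr0n/=; exact: cvg_cst.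
pose a := ln t.
have ck : a / k.+1%:R @[k --> \oo] --> (0 : R).
  rewrite -[X in _ --> X](mulr0 a); apply: cvgMl_tmp; exact: cvg_harmonic.
have c1 : 1 + a / k.+1%:R @[k --> \oo] --> (1 : R).
  rewrite -[X in _ --> X]addr0; apply: cvgD => //; exact: cvg_cst.
apply: (@squeeze_cvgr _ _ _ _ (fun k : nat => expR (a / (1 + a / k.+1%:R))) (cst t)).
- have : \forall k \near \oo, 0 < 1 + a / k.+1%:R.
    exact: cvgr_gt c1 _ ltr01.
  apply: filterS => k ka; apply/andP; split; last first.
    by apply: tent_exprn_le => //; exact: ltW.
  have kn : k.+1%:R != 0 :> R by rewrite pnatr_eq0.
  rewrite /tent t0 (max_r (ltW ka)).
  rewrite (_ : a / (1 + a / k.+1%:R) =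
     k.+1%:R * ((a / k.+1%:R) / (1 + a / k.+1%:R))); last first.
    by rewrite mulrA mulrCA mulfV// mulr1.
  rewrite expRM_natl lerXn2r ?nnegrE ?expR_ge0 ?(ltW ka)//.
  by apply: expR_ratio_le; rewrite -subr_gt0 opprK addrC.
- rewrite -[X in _ --> X](lnK t0).
  apply: continuous_cvg; first exact: continuous_expR.
  rewrite -[X in _ --> X]divr1; apply: cvgM; first exact: cvg_cst.
  by apply: cvgV => //; exact: oner_neq0.
- exact: cvg_cst.
Qed.

Lemma cvg_tent_ln (t : R) : 0 <= t ->
  tent k.+1 t ^+ k.+1 * ln (tent k.+1 t ^+ k.+1) @[k --> \oo] --> t * ln t.
Proof.
rewrite le_eqVlt => /orP[/eqP <-|t0].
  rewrite mul0r /tent ltxx; under eq_fun do rewrite expr0n mul0r; exact: cvg_cst.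
apply: cvgM; first exact/cvg_tent/ltW.
by apply: continuous_cvg; [exact: continuous_ln|exact/cvg_tent/ltW].
Qed.

End tent_limit.

Section real_integrals.
Context d (T : measurableType d) (R : realType) (mu : {measure set T -> \bar R}).

Lemma cvg_Rintegral_dominated (h_ : nat -> T -> R) (h H : T -> R) :
  (forall k, measurable_fun setT (h_ k)) -> measurable_fun setT h ->
  (forall x, h_ k x @[k --> \oo] --> h x) ->
  mu.-integrable setT (EFin \o H) -> (forall k x, `|h_ k x| <= H x) ->
  \int[mu]_x h_ k x @[k --> \oo] --> \int[mu]_x h x.
Proof.
move=> mh_ mh h_h iH h_H.
have hE x : (h_ k x)%:E @[k --> \oo] --> (h x)%:E.
  by apply/fine_cvgP; split; [exact: nearW|exact: h_h].
have [ih _ cv] := @dominated_convergence _ _ _ mu setT measurableT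
  (fun k x => (h_ k x)%:E) (EFin \o h) (EFin \o H)
  (fun k => (measurable_EFinP _ _).2 (mh_ k)) ((measurable_EFinP _ _).2 mh)
  (aeW _ (fun x _ => hE x)) iH (aeW _ (fun x k _ => h_H k x)).
apply: fine_cvg; rewrite fineK; last exact: integrable_fin_num.
exact: cv.
Qed.

(* Jensen's inequality, from [ln s <= s - 1] at [s = u ^ 2 / a] with [a] the
   mean of [u ^ 2] for the weight [u ^ m]; small [a] show that this mean is
   positive. *)
Lemma entropy_moment_le (u : T -> R) (m : nat) : (0 < m)%N ->
  (forall x, 0 <= u x) ->
  mu.-integrable setT (fun x => (u x ^+ m)%:E) ->
  mu.-integrable setT (fun x => (u x ^+ m * u x ^+ 2)%:E) ->
  mu.-integrable setT (fun x => (u x ^+ m * ln (u x ^+ m))%:E) ->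
  let S := \int[mu]_x (u x ^+ m) in
  0 < S ->
  expR (2 * ((\int[mu]_x (u x ^+ m * ln (u x ^+ m))) / S)) <=
  ((\int[mu]_x (u x ^+ m * u x ^+ 2)) / S) ^+ m.
Proof.
move=> m0 u0 iS iT iE S S0.
set Q := \int[mu]_x (u x ^+ m * u x ^+ 2).
set E := \int[mu]_x (u x ^+ m * ln (u x ^+ m)).
have mp : 0 < m%:R :> R by rewrite ltr0n.
have iZ (k : R) (w : T -> R) : mu.-integrable setT (EFin \o w) ->
    mu.-integrable setT (EFin \o (fun x => k * w x)).
  by move=> iw; have := integrableZl measurableT k iw; exact: eq_integrable.
have key a : 0 < a -> 2 / m%:R * E - ln a * S <= a^-1 * Q - S.
  move=> a0.
  have point x : 2 / m%:R * (u x ^+ m * ln (u x ^+ m)) - ln a * u x ^+ m <=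
      a^-1 * (u x ^+ m * u x ^+ 2) - u x ^+ m.
    have [->|ux] := eqVneq (u x) 0.
      by rewrite !expr0n (gtn_eqF m0)/= !mul0r !mulr0.
    have up : 0 < u x by rewrite lt_neqAle eq_sym ux u0.
    have -> : a^-1 * (u x ^+ m * u x ^+ 2) - u x ^+ m =
        u x ^+ m * (u x ^+ 2 / a - 1) by ring.
    have -> : 2 / m%:R * (u x ^+ m * ln (u x ^+ m)) - ln a * u x ^+ m =
        u x ^+ m * (2 * ln (u x) - ln a).
      by rewrite lnXn// -[ln _ *+ _]mulr_natl; field; rewrite gt_eqF.
    rewrite ler_wpM2l ?exprn_ge0// mulr_natl -lnXn// -ln_div ?posrE ?exprn_gt0//.
    rewrite -[X in ln X](subrK 1) addrC le_ln1Dx// ltrBrDl subrr.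
    by rewrite divr_gt0// exprn_gt0.
  rewrite /E /Q /S -!RintegralZl//.
  have i1 : mu.-integrable setT
      (EFin \o (fun x => 2 / m%:R * (u x ^+ m * ln (u x ^+ m)))).
    exact: iZ.
  have i2 : mu.-integrable setT (EFin \o (fun x => ln a * u x ^+ m)).
    exact: iZ.
  have i3 : mu.-integrable setT (EFin \o (fun x => a^-1 * (u x ^+ m * u x ^+ 2))).
    exact: iZ.
  rewrite -RintegralB// -RintegralB//.
  apply: le_Rintegral => //.
  - by have := integrableB measurableT i1 i2; exact: eq_integrable.
  - by have := integrableB measurableT i3 iS; exact: eq_integrable.
have Q0 : 0 < Q.
  have Q0 : 0 <= Q by apply: Rintegral_ge0 => x _; rewrite mulr_ge0 ?exprn_ge0.
  rewrite lt_neqAle Q0 andbT eq_sym; apply/eqP => QE.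
  have := key (expR ((2 / m%:R * E + S) / S - 1)) (expR_gt0 _).
  rewrite QE mulr0 expRK mulrBl divfK ?gt_eqF// mul1r; lra.
have ak : 0 < Q / S by rewrite divr_gt0.
have := key _ ak; rewrite invf_div divfK ?gt_eqF// subrr subr_le0 => h.
rewrite -[X in _ <= X ^+ m](lnK ak) -expRM_natl ler_expR.
have -> : 2 * (E / S) = m%:R * (2 / m%:R * E / S).
  by field; rewrite !gt_eqF.
by rewrite ler_pM2l// ler_pdivrMr.
Qed.

End real_integrals.

Section limit_inequality.
Context (R : realType) (n : nat) (f : 'rV[R]_n -> R).
Hypotheses (f0 : forall x, 0 <= f x) (fc : mult_concave f) (fe : even_fun f).
Hypothesis fo : forall s, open [set x | f x < s].
Context (c d : R).
Hypotheses (c0 : 0 < c) (d0 : 0 < d) (fcd : forall x, box R n d x -> c <= f x).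
Local Notation lam := (borel_lebesgue R n).
Hypothesis fi : lam.-integrable setT (EFin \o (f : borel_rV R n -> R)).
Hypothesis HK : forall m : nat, (1 <= m)%N -> forall K : set 'rV[R]_(n + m),
  convex_body K -> centrally_symmetric K ->
  isotropic_constant K <= 1 / Num.sqrt 12.

Let p (x : 'rV[R]_n) : R := f x `^ 4^-1.
Let M := \int[lam]_x f x.
Let E := \int[lam]_x (f x * ln (f x)).
Let A : 'M[R]_n := \matrix_(i, j)
  (\int[lam]_x ((x : 'rV[R]_n) 0 i * (x : 'rV[R]_n) 0 j * f x) / M).

Let w k (x : 'rV[R]_n) : R := tent k.+1 (f x) ^+ k.+1.
Let S_ k := \int[lam]_x w k x.
Let E_ k := \int[lam]_x (w k x * ln (w k x)).
Let T_ k := \int[lam]_x (w k x * tent k.+1 (f x) ^+ 2).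
Let A_ k : 'M[R]_n := \matrix_(i, j)
  (\int[lam]_x ((x : 'rV[R]_n) 0 i * (x : 'rV[R]_n) 0 j * w k x) / S_ k).

Let mf : measurable_fun setT (f : borel_rV R n -> R).
Proof. by case/integrableP: fi => /measurable_EFinP. Qed.

Let mcoord i : measurable_fun setT (fun x : borel_rV R n => (x : 'rV[R]_n) 0 i).
Proof. exact: measurable_coord. Qed.

Let mtent k : measurable_fun setT (fun x : borel_rV R n => tent k (f x)).
Proof. by apply: measurableT_comp mf; exact: measurable_tent. Qed.

Let mw k : measurable_fun setT (w k : borel_rV R n -> R).
Proof. exact: measurable_funX. Qed.

Let ip : lam.-integrable setT (EFin \o (p : borel_rV R n -> R)).
Proof. exact: (integrable_fourth_root f0 fc c0 d0 fcd fi). Qed.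

Let iKp (K : R) : lam.-integrable setT (EFin \o (fun x : borel_rV R n => K * p x)).
Proof. by have := integrableZl measurableT K ip; exact: eq_integrable. Qed.

Let w0 k x : 0 <= w k x. Proof. by rewrite exprn_ge0// tent_ge0. Qed.

Let wf k x : w k x <= f x. Proof. exact: tent_exprn_le. Qed.

Let idom (h : borel_rV R n -> R) K : measurable_fun setT h ->
  (forall x, `|h x| <= K * p x) -> lam.-integrable setT (fun x => (h x)%:E).
Proof.
move=> mh hK; apply: (@le_integrable _ _ _ lam setT measurableT _ _ _ _ (iKp K)).
  exact/measurable_EFinP.
by move=> x _; rewrite /= lee_fin (le_trans (hK x))// ler_norm.
Qed.

Let wK : exists K, forall k x, `|w k x| <= K * p x.
Proof.
have [K fK] := fun_domination f0 fc fe.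
by exists K => k x; rewrite ger0_norm// (le_trans (wf k x)).
Qed.

Let AK : exists K, forall k (x : 'rV[R]_n) i j, `|x 0 i * x 0 j * w k x| <= K * p x.
Proof.
have [K fK] := moment_domination f0 fc fe c0 d0 fcd fi.
exists K => k x i j; apply: le_trans (fK x i j).
by rewrite normrM [leRHS]normrM ler_wpM2l// !ger0_norm.
Qed.

Let EK : exists K, forall k x, `|w k x * ln (w k x)| <= K * p x.
Proof.
have [K fK] := entropy_domination f0 fc fe.
by exists K => k x; apply: fK; rewrite w0 wf.
Qed.

Let mwln k : measurable_fun setT (fun x : borel_rV R n => w k x * ln (w k x)).
Proof.
by apply: measurable_funM => //; apply: measurableT_comp => //; exact: measurable_ln.
Qed.

Let mA k i j : measurable_fun setT
  (fun x : borel_rV R n => (x : 'rV[R]_n) 0 i * (x : 'rV[R]_n) 0 j * w k x).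
Proof. by apply: measurable_funM => //; exact: measurable_funM. Qed.

Let iS k : lam.-integrable setT (fun x : borel_rV R n => (w k x)%:E).
Proof. by have [K wK'] := wK; apply: (idom (mw k)). Qed.

Let iE k : lam.-integrable setT (fun x : borel_rV R n => (w k x * ln (w k x))%:E).
Proof. by have [K EK'] := EK; apply: (idom (mwln k)). Qed.

Let iA k i j : lam.-integrable setT (fun x : borel_rV R n =>
  ((x : 'rV[R]_n) 0 i * (x : 'rV[R]_n) 0 j * w k x)%:E).
Proof. by have [K AK'] := AK; apply: (idom (mA k i j)). Qed.

Let iT k : lam.-integrable setT (fun x : borel_rV R n =>
  (w k x * tent k.+1 (f x) ^+ 2)%:E).
Proof.
have [K wK'] := wK.
apply: (@idom _ ((1 + f 0) ^+ 2 * K)).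
  by apply: measurable_funM => //; exact: measurable_funX.
move=> x; rewrite normrM mulrC -mulrA ler_pM//.
rewrite ger0_norm ?sqr_ge0// lerXn2r// ?nnegrE ?tent_ge0// ?addr_ge0//.
by apply: le_trans (tent_le _ _) _ => //; rewrite lerD2l le_fun0.
Qed.

Let cS : S_ k @[k --> \oo] --> M.
Proof.
have [K wK'] := wK.
apply: (@cvg_Rintegral_dominated _ _ R lam w f (fun x => K * p x)) => // x.
exact: cvg_tent.
Qed.

Let cE : E_ k @[k --> \oo] --> E.
Proof.
have [K EK'] := EK.
apply: (@cvg_Rintegral_dominated _ _ R lam (fun k x => w k x * ln (w k x))
  (fun x => f x * ln (f x)) (fun x => K * p x)) => //.
  by apply: measurable_funM => //; apply: measurableT_comp => //; exact: measurable_ln.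
by move=> x; exact: cvg_tent_ln.
Qed.

Hypothesis M0 : 0 < M.

Let cA : \det (A_ k) @[k --> \oo] --> \det A.
Proof.
have [K AK'] := AK.
apply: cvg_det => i j; under eq_cvg do rewrite mxE.
rewrite mxE; apply: cvgM; last by apply: cvgV; rewrite ?gt_eqF.
apply: (@cvg_Rintegral_dominated _ _ R lam
  (fun k (x : 'rV[R]_n) => x 0 i * x 0 j * w k x)
  (fun x : 'rV[R]_n => x 0 i * x 0 j * f x) (fun x => K * p x)) => //.
  by apply: measurable_funM => //; exact: measurable_funM.
by move=> x; apply: cvgMl_tmp; exact: cvg_tent.
Qed.

Let body_ineq k : expR (- (k.+1%:R / 2)) <= c ->
  0 < S_ k /\ \det (A_ k) * (T_ k / S_ k) ^+ k.+1 <= S_ k ^+ 2 / 12 ^+ n.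
Proof.
move=> kc.
have [C _ fC] := coord_decay f0 fc fe c0 d0 fcd fi.
have cK : convex_set (power_body k.+1 f) by exact: power_body_convex.
have clK : closed (power_body k.+1 f) by exact: power_body_closed.
have coK : compact (power_body k.+1 f).
  apply: bounded_closed_compact => //.
  exact: (power_body_bounded f0 fc fe (ltn0Sn k) c0 d0 fcd fC).
have iK : (power_body k.+1 f)° !=set0.
  exact: (power_body_interior d0 fcd kc).
have sK : centrally_symmetric (power_body k.+1 f) by exact: power_body_sym.
have mK := compact_measurable_rV coK.
have V0 : 0 < vol (power_body k.+1 f).
  rewrite /vol lebesgue_rV_borel// fine_gt0//.
  by rewrite interior_lebesgue_gt0// compact_lebesgue_lty.
split.
  move: V0; rewrite vol_power_bodyE//; last exact: (iS k).
  by rewrite pmulr_rgt0// exprn_gt0.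
have := power_body_inequality fe (ltn0Sn k) mK (iS k) (iT k) (iA k) V0.
by apply; apply: HK.
Qed.

Lemma det_covariance_entropy_le : 0 <= \det A ->
  \det A * expR (2 * (E / M)) <= M ^+ 2 / 12 ^+ n.
Proof.
rewrite le_eqVlt => /orP[/eqP <-|A0].
  by rewrite mul0r divr_ge0// exprn_ge0// ltW.
have cL : \det (A_ k) * expR (2 * (E_ k / S_ k)) @[k --> \oo] -->
    \det A * expR (2 * (E / M)).
  apply: cvgM => //; apply: continuous_cvg; first exact: continuous_expR.
  by apply: cvgMl_tmp; apply: cvgM => //; apply: cvgV; rewrite ?gt_eqF.
have cR : S_ k ^+ 2 / 12 ^+ n @[k --> \oo] --> M ^+ 2 / 12 ^+ n.
  by apply: cvgMr_tmp; under eq_cvg do rewrite expr2; rewrite expr2; apply: cvgM.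
rewrite -(cvg_lim _ cL)// -(cvg_lim _ cR)//; apply: ler_lim.
- by apply/cvg_ex; eexists; exact: cL.
- by apply/cvg_ex; eexists; exact: cR.
have kc : \forall k \near \oo, expR (- (k.+1%:R / 2)) <= c.
  have := nbhs_infty_ger (- (2 * ln c)).
  apply: filterS => k kc; rewrite -[leRHS]lnK ?posrE// ler_expR -natr1; lra.
have Ak : \forall k \near \oo, 0 < \det (A_ k) by exact: cvgr_gt cA _ A0.
apply: filterS2 kc Ak => k /body_ineq[S0 h] dAk.
apply: le_trans h; rewrite ler_pM2l//.
apply: entropy_moment_le => //;
  [by move=> x; exact: tent_ge0|exact: (iS k)|exact: (iT k)|exact: (iE k)].
Qed.

End limit_inequality.

Lemma Rintegral_sum d (T : measurableType d) (R : realType)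
    (mu : {measure set T -> \bar R}) (I : Type) (s : seq I) (h : I -> T -> R) :
  (forall i, mu.-integrable setT (EFin \o h i)) ->
  \int[mu]_x (\sum_(i <- s) h i x) = \sum_(i <- s) \int[mu]_x h i x /\
  mu.-integrable setT (EFin \o (fun x => \sum_(i <- s) h i x)).
Proof.
move=> hi; elim: s => [|i s [IH1 IH2]].
  under eq_Rintegral do rewrite big_nil.
  rewrite Rintegral_cst//= mul0r big_nil; split => //.
  under [X in _.-integrable _ X]eq_fun do rewrite /= big_nil.
  exact: integrable0.
have E : (fun x => \sum_(j <- i :: s) h j x) =
    (fun x => h i x + \sum_(j <- s) h j x).
  by apply/funext => x; rewrite big_cons.
rewrite E RintegralD// big_cons IH1; split => //.
by have := integrableD measurableT (hi i) IH2; exact: eq_integrable.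
Qed.

Section reduction.
Context (R : realType) (n : nat).
Local Notation mu := (lebesgue_rV R n).
Local Notation lam := (borel_lebesgue R n).
Local Notation C := (caratheodory_type (lam^*)%mu).

Lemma covariance_psd (F : borel_rV R n -> R) (M : R) :
  (forall x, 0 <= F x) -> 0 <= M ->
  (forall i j, lam.-integrable setT (fun x : borel_rV R n =>
    ((x : 'rV[R]_n) 0 i * (x : 'rV[R]_n) 0 j * F x)%:E)) ->
  0 <= \det (\matrix_(i < n, j < n)
    (\int[lam]_x ((x : 'rV[R]_n) 0 i * (x : 'rV[R]_n) 0 j * F x) / M)).
Proof.
move=> F0 M0 iA; apply: psd_det_ge0 => v.
pose h (q : 'I_n * 'I_n) (x : borel_rV R n) : R :=
  v 0 q.1 * v 0 q.2 * ((x : 'rV[R]_n) 0 q.1 * (x : 'rV[R]_n) 0 q.2 * F x).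
have hi q : lam.-integrable setT (EFin \o h q).
  have := integrableZl measurableT (v 0 q.1 * v 0 q.2) (iA q.1 q.2).
  exact: eq_integrable.
have [hs _] := Rintegral_sum (index_enum _) hi.
suff -> : (v *m (\matrix_(i < n, j < n)
    (\int[lam]_x ((x : 'rV[R]_n) 0 i * (x : 'rV[R]_n) 0 j * F x) / M)) *m v^T) 0 0 =
    \int[lam]_x (\sum_q h q x) / M.
  apply: divr_ge0 => //; apply: Rintegral_ge0 => x _.
  have -> : \sum_q h q x = (\sum_i v 0 i * (x : 'rV[R]_n) 0 i) ^+ 2 * F x.
    rewrite -(pair_bigA _ (fun i j => h (i, j) x))/= expr2 !mulr_suml.
    apply: eq_bigr => i _; rewrite mulr_sumr mulr_suml; apply: eq_bigr => j _.
    by rewrite /h/=; ring.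
  by rewrite mulr_ge0// sqr_ge0.
rewrite hs -(pair_bigA _ (fun i j => \int[lam]_x h (i, j) x))/= exchange_big/=.
rewrite mxE mulr_suml; apply: eq_bigr => j _.
rewrite !mxE mulr_suml mulr_suml; apply: eq_bigr => i _.
by rewrite mxE RintegralZl//=; [ring|exact: iA].
Qed.

#[local] Instance ae_lebesgue_rV_filter : Filter (nbhs (almost_everywhere mu)).
Proof. exact: (@ae_filter_ringOfSetsType _ _ _ mu). Qed.

Lemma Rintegral_ae (g1 g2 : 'rV[R]_n -> R) :
  measurable_fun setT (g1 : C -> R) -> measurable_fun setT (g2 : borel_rV R n -> R) ->
  {ae mu, forall x, g1 x = g2 x} ->
  \int[mu]_x g1 x = \int[lam]_x g2 x.
Proof.
move=> m1 m2 g12; rewrite -(@Rintegral_lebesgue_rV R n setT g2 measurableT m2).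
rewrite /Rintegral; congr fine; apply: ae_eq_integral.
- exact: measurableT.
- exact/measurable_EFinP.
- exact/measurable_EFinP/(measurable_fun_lebesgue_rV measurableT m2).
- by apply: filterS g12 => x /= ->.
Qed.

Lemma isotropic_constant_fun_ae (f F : 'rV[R]_n -> R) :
  measurable_fun setT (f : C -> R) -> measurable_fun setT (F : borel_rV R n -> R) ->
  {ae mu, forall x, f x = F x} -> even_fun F ->
  let M := \int[lam]_x F x in
  isotropic_constant_fun f =
  (expR ((\int[lam]_x (F x * ln (F x))) / M) / M) `^ n%:R^-1 *
  (\det (\matrix_(i < n, j < n)
    (\int[lam]_x ((x : 'rV[R]_n) 0 i * (x : 'rV[R]_n) 0 j * F x) / M))) `^
  (2 * n%:R)^-1.
Proof.
move=> mf mF fF eF M.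
have mc i : measurable_fun setT (fun x : borel_rV R n => (x : 'rV[R]_n) 0 i).
  exact: measurable_coord.
have mcC i : measurable_fun setT (fun x : C => (x : 'rV[R]_n) 0 i).
  exact: (measurable_fun_lebesgue_rV measurableT (mc i)).
have massE : mass f = M by exact: Rintegral_ae.
have entE : - entropy f = (\int[lam]_x (F x * ln (F x))) / M.
  rewrite /entropy opprK massE; congr (_ / _); apply: Rintegral_ae.
  - by apply: (measurable_funM mf); apply: measurableT_comp mf; exact: measurable_ln.
  - by apply: measurable_funM => //; apply: measurableT_comp mF; exact: measurable_ln.
  - by apply: filterS fF => x /= ->.
have barE : barycenter_fun f = 0.
  apply/rowP => i; rewrite !mxE.
  rewrite (@Rintegral_ae _ (fun x => x 0 i * F x)).
  - rewrite (@Rintegral_odd _ _ (fun=> -1)) ?mul0r//.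
    + by move=> _; rewrite normrN1.
    + exact: measurable_funM.
    + move=> x; rewrite (_ : diag_scale _ x = - x); last first.
        by apply/rowP => k; rewrite !mxE mulN1r.
      by rewrite eF mxE mulNr.
  - exact: measurable_funM (mcC i) mf.
  - exact: measurable_funM (mc i) mF.
  - by apply: filterS fF => x /= ->.
rewrite /isotropic_constant_fun entE massE; congr (_ * (\det _) `^ _).
rewrite /covariance_mx_fun barE mulmx0 subr0; apply/matrixP => i j.
rewrite !mxE massE; congr (_ / _).
apply: Rintegral_ae.
- exact: measurable_funM (measurable_funM (mcC i) (mcC j)) mf.
- exact: measurable_funM (measurable_funM (mc i) (mc j)) mF.
- by apply: filterS fF => x /= ->.
Qed.

End reduction.

Lemma isotropic_constant_fun_le (R : realType) (n : nat) : (0 < n)%N ->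
  (forall m : nat, (1 <= m)%N -> forall K : set 'rV[R]_(n + m),
    convex_body K -> centrally_symmetric K ->
    isotropic_constant K <= 1 / Num.sqrt 12) ->
  forall f : 'rV[R]_n -> R,
    log_concave f -> even_fun f -> integrable_rV f -> 0 < mass f ->
    isotropic_constant_fun f <= 1 / Num.sqrt 12.
Proof.
move=> n0 HK f lf fe fi M0.
have f0 x : 0 <= f x := log_concave_ge0 x lf.
have fc := log_concave_mult_concave lf.
have [c [d [c0 d0 fcd]]] := mult_concave_ge_box f0 fc fe fi M0.
pose F := radial_inf f.
have F0 x : 0 <= F x by exact: radial_inf_ge0.
have Fc : mult_concave F by exact: radial_inf_mult_concave.
have Fe : even_fun F by exact: radial_inf_even.
have Fcd x : box R n d x -> c <= F x.
  by move=> /fcd cx; apply: le_trans cx _; exact: radial_inf_ge_fun.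
have Fo s : open [set x | F x < s] by exact: (radial_inf_open f0 fc c0 d0 fcd).
have mF : measurable_fun setT (F : borel_rV R n -> R).
  exact: (measurable_radial_inf f0 fc c0 d0 fcd).
have Fi := integrable_radial_inf f0 fc c0 d0 fcd fi.
have fF := radial_inf_ae f0 fc fe c0 d0 fcd fi.
have mf : measurable_fun setT
    (f : caratheodory_type ((borel_lebesgue R n)^*)%mu -> R).
  by case/integrableP: fi => /measurable_EFinP.
have fF' : {ae lebesgue_rV R n, forall x, f x = F x}.
  by apply: filterS fF => x /= /(_ I) [].
pose M := \int[borel_lebesgue R n]_x F x.
have ME : mass f = M by exact: Rintegral_ae.
rewrite (isotropic_constant_fun_ae mf mF fF' Fe) -/M.
have Mp : 0 < M by rewrite -ME.
have [K FK] := moment_domination F0 Fc Fe c0 d0 Fcd Fi.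
have iA i j : (borel_lebesgue R n).-integrable setT
    (fun x : borel_rV R n =>
      ((x : 'rV[R]_n) 0 i * (x : 'rV[R]_n) 0 j * F x)%:E).
  have ip := integrable_fourth_root F0 Fc c0 d0 Fcd Fi.
  have iKp := integrableZl measurableT K ip.
  apply: (@le_integrable _ _ _ (borel_lebesgue R n) setT measurableT _ _ _ _ iKp).
    apply/measurable_EFinP; apply: measurable_funM => //.
    by apply: measurable_funM; exact: measurable_coord.
  by move=> x _; rewrite /= lee_fin (le_trans (FK x i j))// ler_norm.
have D0 := covariance_psd F0 (ltW Mp) iA.
apply: isotropic_le_of_det => //.
exact: (det_covariance_entropy_le F0 Fc Fe Fo c0 d0 Fcd Fi HK).
Qed.

Theorem proposition5p1 (R : realType) (n : nat) (hn : (1 <= n)%N) :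
  [/\ forall m : nat, (1 <= m)%N ->
        isotropic_constant (cube R (n + m)) = 1 / Num.sqrt 12,
      isotropic_constant_fun (f_infty R n) = 1 / Num.sqrt 12,
      isotropic_constant (cube R n) = 1 / Num.sqrt 12,
      (forall m : nat, (1 <= m)%N ->
         forall K : set 'rV[R]_(n + m),
           convex_body K -> centrally_symmetric K ->
           isotropic_constant K <= isotropic_constant (cube R (n + m))) ->
      (forall f : 'rV[R]_n -> R,
         log_concave f -> even_fun f -> integrable_rV f -> 0 < mass f ->
         isotropic_constant_fun f <= isotropic_constant_fun (f_infty R n))
    & (forall f : 'rV[R]_n -> R,
         log_concave f -> even_fun f -> integrable_rV f -> 0 < mass f ->
         isotropic_constant_fun f <= isotropic_constant_fun (f_infty R n)) ->
      (forall K : set 'rV[R]_n,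
         convex_body K -> centrally_symmetric K ->
         isotropic_constant K <= isotropic_constant (cube R n))].
Proof.
have cubeE d : (0 < d)%N -> isotropic_constant (cube R d) = 1 / Num.sqrt 12.
  exact: isotropic_constant_cube.
have f_inftyE : isotropic_constant_fun (f_infty R n) = 1 / Num.sqrt 12.
  rewrite /f_infty isotropic_constant_fun_indic ?cubeE//.
  exact: measurable_symbox.
split.
- by move=> m m0; rewrite cubeE// addn_gt0 hn.
- exact: f_inftyE.
- exact: cubeE.
- move=> HK; rewrite f_inftyE; apply: isotropic_constant_fun_le => // m m0 K cK sK.
  by rewrite -(cubeE (n + m)%N) ?addn_gt0 ?hn//; exact: HK.
- by move=> Hf; rewrite cubeE// -f_inftyE; exact: isotropic_constant_le_of_functions.
Qed.
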